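(* Let $\{W_t\}_{t\ge 0}$ be a standard Brownian motion, let $t>0$ and let $M_t=\max_{0\le s\le t}W_s$. Then the copula $C_{W_t,M_t}$ of the pair $(W_t,M_t)$ is given, for $(u,v)\in(0,1)^2$, by $$C_{W_t,M_t}(u,v)=\begin{cases} u-\Phi\left(\Phi^{-1}(u)-2\Phi^{-1}\left(\frac{v+1}{2}\right)\right) & \text{if } u\le \frac{v+1}{2},\\ v & \text{if } u>\frac{v+1}{2},\end{cases}$$ and its associated density function is $$c_{W_t,M_t}(u,v)=\frac{\left[2\Phi^{-1}\left(\frac{v+1}{2}\right)-\Phi^{-1}(u)\right]\phi\left(2\Phi^{-1}\left(\frac{v+1}{2}\right)-\Phi^{-1}(u)\right)}{\phi\left(\Phi^{-1}\left(\frac{v+1}{2}\right)\right)\phi\left(\Phi^{-1}(u)\right)}$$ whenever $u\le\frac{v+1}{2}$, and zero otherwise.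
   Context: $\Phi$ and $\phi$ denote the standard normal distribution function and density. Standard Brownian motion starts at $0$. For random variables $X_1,X_2$ with continuous distribution functions $F_1,F_2$ and joint distribution function $F$, the copula of $(X_1,X_2)$ is the unique function $C:[0,1]^2\to[0,1]$ that is a distribution function with uniform margins and satisfies $F(x_1,x_2)=C(F_1(x_1),F_2(x_2))$ for all $x_1,x_2$; equivalently $C(u_1,u_2)=F(F_1^{-1}(u_1),F_2^{-1}(u_2))$ for $(u_1,u_2)\in(0,1)^2$, where $F_i^{-1}(u)=\inf\{x: F_i(x)\ge u\}$. The density function associated with $C$ is the function $c=\frac{\partial^2}{\partial u\,\partial v}C$, understood as the probability density of the distribution $C$ with respect to Lebesgue measure on $(0,1)^2$ (so values on a Lebesgue-null set are immaterial). *)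

(* Defs.v *)
From HB Require Import structures.
From mathcomp Require Import all_boot all_order all_algebra.
From mathcomp Require Import all_classical all_reals all_analysis.
Import Order.TTheory GRing.Theory Num.Theory.
Import numFieldNormedType.Exports.

Set Implicit Arguments.
Unset Strict Implicit.
Unset Printing Implicit Defensive.

Local Open Scope classical_set_scope.
Local Open Scope ring_scope.

Section normal.
Context {R : realType}.

Definition Phi (x : R) : R := fine (normal_prob 0 1 `]-oo, x]).

Definition phi (x : R) : R := normal_pdf 0 1 x.

(* F^{-1}(u) = inf {x | F x >= u}; meaningful for 0 < u < 1. *)
Definition quantile (F : R -> R) (u : R) : R := inf [set x | u <= F x].

Definition Phi_inv : R -> R := quantile Phi.

End normal.

Section brownian.
Context d (T : measurableType d) (R : realType) (P : probability T R).

(* The sets B i may be taken to be setT, so the product rule over the whole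
   finite family contains the one over each subfamily. *)
Definition mutually_independent (I : finType) (X : I -> T -> R) : Prop :=
  forall B : I -> set R, (forall i, measurable (B i)) ->
  P (\bigcap_(i in [set: I]) (X i @^-1` B i)) =
  (\prod_(i : I) P (X i @^-1` B i))%E.

Definition increment (W : R -> {RV P >-> R}) (s t : R) : T -> R :=
  W t \- W s.

(* The process is indexed by the whole of R, but only the W t with 0 <= t are
   constrained. The second parameter of normal_prob is the standard deviation. *)
Definition standard_brownian_motion (W : R -> {RV P >-> R}) : Prop :=
  [/\ {ae P, forall w, W 0 w = 0},
      (forall (n : nat) (s : nat -> R), 0 <= s 0%N ->
         (forall i, s i <= s i.+1) ->
         mutually_independent (fun i : 'I_n => increment W (s i) (s i.+1))),
      (forall s t, 0 <= s -> s < t -> forall A : set R, measurable A ->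
         P (increment W s t @^-1` A) =
         normal_prob 0 (Num.sqrt (t - s)) A) &
      {ae P, forall w, {within `[0, +oo[, continuous (fun t => W t w)}}].

(* M is almost surely max_{0 <= s <= t} W_s (the maximum is attained). *)
Definition running_max (W : R -> {RV P >-> R}) (t : R) (M : {RV P >-> R}) :
    Prop :=
  {ae P, forall w, [set W s w | s in `[0, t]] (M w) /\
                   ubound [set W s w | s in `[0, t]] (M w)}.

End brownian.

Section copula.
Context {R : realType}.

(* mu is a probability on the plane whose two margins are uniform on [0, 1],
   and C is its distribution function on [0, 1]^2; the values of C outside of
   [0, 1]^2 are irrelevant. *)
Definition copula_law (C : R -> R -> R) (mu : probability (R * R)%type R) :
    Prop :=
  [/\ (forall A : set R, measurable A ->
         mu (fst @^-1` A) = uniform_prob (@ltr01 R) A),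
      (forall A : set R, measurable A ->
         mu (snd @^-1` A) = uniform_prob (@ltr01 R) A) &
      (forall u v, 0 <= u <= 1 -> 0 <= v <= 1 ->
         mu (`]-oo, u] `*` `]-oo, v]) = (C u v)%:E)].

Definition is_copula (C : R -> R -> R) : Prop := exists mu, copula_law C mu.

Definition fcdf d (T : measurableType d) (P : probability T R)
  (X : {RV P >-> R}) (x : R) : R := fine (cdf X x).

Definition copula_of d (T : measurableType d) (P : probability T R)
    (X1 X2 : {RV P >-> R}) (C : R -> R -> R) : Prop :=
  [/\ continuous (fcdf X1), continuous (fcdf X2), is_copula C &
      forall x1 x2, P [set w | X1 w <= x1 /\ X2 w <= x2] =
                    (C (fcdf X1 x1) (fcdf X2 x2))%:E].

Definition unit_square : set (R * R) := `]0, 1[ `*` `]0, 1[.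

(* c is a density, with respect to the Lebesgue measure on (0, 1)^2, of the
   probability measure with distribution function C. *)
Definition copula_density (C : R -> R -> R) (c : R -> R -> R) : Prop :=
  exists mu : probability (R * R)%type R,
  [/\ copula_law C mu,
      measurable_fun unit_square (fun p => c p.1 p.2),
      (forall p, unit_square p -> 0 <= c p.1 p.2) &
      forall A : set (R * R), measurable A ->
        mu A = (\int[lebesgue_measure \x lebesgue_measure]_(p in A `&` unit_square)
                  (c p.1 p.2)%:E)%E].

End copula.

(* Main.v *)
(** Reflection principle, first for a random walk with independent symmetric
    steps: changing the sign of all the steps after the first time [k] at which
    the walk exceeds [m] preserves the law of the steps and turns [S n <= x]
    into [2 * S k - S n <= x].  Since [S k] overshoots [m] by at most one step,
    the probability that the walk exceeds [m] and ends below [x <= m] lies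
    between those of [2 * m - x < S n] and of [2 * (m + e) - x <= S n] with all
    steps at most [e].  Applied to the increments of [W] along finer and finer
    grids of [[0, t]], with uniform continuity of the paths, this gives
    [P (m < M, W t <= x) = 1 - Phi ((2 * m - x) / sqrt t)], hence the joint
    distribution function and the copula.  The density is recovered by
    integrating it over rectangles (Tonelli and the fundamental theorem of
    calculus), which determine a measure on the unit square. *)
Require Import Defs.
From HB Require Import structures.
From mathcomp Require Import all_boot all_order all_algebra.
From mathcomp Require Import all_classical all_reals all_analysis.
From mathcomp Require Import measurable_realfun ring lra.
Import Order.TTheory GRing.Theory Num.Theory.
Import numFieldNormedType.Exports.

Set Implicit Arguments.
Unset Strict Implicit.
Unset Printing Implicit Defensive.

Local Open Scope classical_set_scope.
Local Open Scope ring_scope.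

(** * Measures on the line *)

(** The first passage time is random, but the reflection is made at a fixed index [k]: being the
    first passage is an event of the first [k] steps alone, and reversing the later signs preserves
    the joint law of the steps. Summing over [k] recovers the whole event. Every grid walk ends
    exactly at [W t - W 0], so both reflection bounds are governed by one fixed normal variable,
    whatever the mesh. The mesh enters only through events that hold for all fine enough grids, path
    by path, and a Fatou argument passes to the limit. For the copula, the obstacle is that a
    continuous distribution function may be flat, as that of the maximum is on the negative
    half-line. Existence therefore compares events up to null sets instead of inverting. Conversely,
    each point of the open square is a value of the pair of distribution functions, which forces the
    value of any copula there. The density is integrated in [v] first because it is an exact
    derivative in [v]; what remains is the derivative in [u] of the copula. *)

Lemma measurable_lrayE (R : realType) :
  (@measurable _ R) = <<s [set A | exists x : R, A = `]-oo, x]%classic] >>.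
Proof.
rewrite eqEsubset; split; last first.
  apply: smallest_sub; first exact: sigma_algebra_measurable.
  by move=> _ [x ->]; exact: measurable_itv.
have -> : (@measurable _ R) =
    (@measurable_realfun.RGenOInfty.G R).-sigma.-measurable.
  exact: measurable_realfun.RGenOInfty.measurableE.
apply: smallest_sub; first exact: smallest_sigma_algebra.
move=> _ [x ->]; rewrite -setCitvl.
have [_ h _] := smallest_sigma_algebra setT
  [set A | exists x : R, A = `]-oo, x]%classic].
by rewrite -setTD; apply: h; apply: sub_sigma_algebra; exists x.
Qed.

Lemma lray_setI (R : realType) (x y : R) :
  `]-oo, x] `&` `]-oo, y] = `]-oo, Num.min x y]%classic.
Proof. by apply/seteqP; split => z /=; rewrite !in_itv/= le_min => /andP. Qed.

Lemma lray_bigcup (R : realType) : \bigcup_n `]-oo, n%:R : R]%classic = setT.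
Proof.
rewrite -subTset => x _; exists (Num.truncn x).+1 => //=.
by rewrite in_itv/= ltW// truncnS_gt.
Qed.

Lemma measureR_unique (R : realType) (m1 m2 : {measure set R -> \bar R}) :
  (forall x, m1 `]-oo, x]%classic = m2 `]-oo, x]%classic) ->
  (forall x, (m1 `]-oo, x]%classic < +oo)%E) ->
  forall A, measurable A -> m1 A = m2 A.
Proof.
move=> m12 moo A mA.
apply: (measure_unique [set A | exists x : R, A = `]-oo, x]%classic]
  (fun n => `]-oo, n%:R : R]%classic)) => //.
- exact: measurable_lrayE.
- by move=> _ _ [x ->] [y ->]; exists (Num.min x y); rewrite lray_setI.
- by move=> i; exists i%:R.
- exact: lray_bigcup.
- by move=> _ [x ->].
Qed.

Section normal_cdf.
Context {R : realType}.
Implicit Types x y s : R.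

Definition ncdf s x : R := fine (normal_prob 0 s `]-oo, x]).

Lemma ncdfE s x : normal_prob 0 s `]-oo, x] = (ncdf s x)%:E.
Proof. by rewrite fineK// fin_num_measure. Qed.

Lemma is_derive_ncdf s x : s != 0 ->
  is_derive x (1 : R) (ncdf s) (normal_pdf 0 s x).
Proof.
move=> s0.
have [] := @continuous_FTC1 R (normal_pdf 0 s) -oo%O x (x + 1).
- by rewrite ltrDl.
- apply: (integrableS measurableT) => //; exact: integrable_normal_pdf.
- by rewrite ltNyr.
- exact: continuous_normal_pdf.
- move=> dF F'E; split => //.
  by rewrite -F'E derive1E.
Qed.

Lemma normal_pdf_gt0 s x : s != 0 -> 0 < normal_pdf 0 s x.
Proof.
by move=> s0; rewrite normal_pdfE// mulr_gt0 ?normal_peak_gt0// expR_gt0.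
Qed.

Lemma ncdf_continuous s : s != 0 -> continuous (ncdf s).
Proof.
move=> s0 x; have [/derivable1_diffP/differentiable_continuous +] :=
  @is_derive_ncdf s x s0.
by [].
Qed.

End normal_cdf.

(** * The normal distribution *)

Section normal_cdf_symmetry.
Context {R : realType}.
Implicit Types x y s : R.

Lemma normal_pdf_scale s x : 0 < s -> normal_pdf 0 s x = s^-1 * phi (x / s).
Proof.
move=> s0; rewrite /phi !normal_pdfE ?oner_eq0 ?gt_eqF// /normal_peak /normal_fun.
rewrite mulrA; congr (_ * expR _); last first.
  by rewrite !subr0; field; rewrite gt_eqF.
rewrite -mulrnAr sqrtrM ?sqr_ge0// sqrtr_sqr gtr0_norm// invfM.
by rewrite expr1n mul1r.
Qed.

(** The identity is a random variable under [normal_prob 0 s] whose cdf is [ncdf s]; the limits of a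
    cdf at infinity thus apply to [ncdf]. *)
Let idR : measurableTypeR R -> R := idfun.
#[local] HB.instance Definition _ :=
  @isMeasurableFun.Build _ _ _ _ idR (@measurable_id _ _ setT).

Lemma ncdf_cvgNy s : ncdf s x @[x --> -oo] --> (0 : R).
Proof.
have := @cvg_cdfNy0 _ _ _ (normal_prob 0 s) (idR : {RV (normal_prob 0 s) >-> R}).
by move=> /fine_cvg.
Qed.

Lemma ncdf_cvgy s : ncdf s x @[x --> +oo] --> (1 : R).
Proof.
have := @cvg_cdfy1 _ _ _ (normal_prob 0 s) (idR : {RV (normal_prob 0 s) >-> R}).
by move=> /fine_cvg.
Qed.

Lemma is_derive_Phi x : is_derive x (1 : R) Phi (phi x).
Proof. exact: (@is_derive_ncdf R 1 x (oner_neq0 R)). Qed.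

Lemma is_derive_Phi_div s x :
  is_derive x (1 : R) (fun x => Phi (x / s)) (s^-1 * phi (x / s)).
Proof.
have h : is_derive x (1 : R) (fun x : R => x / s) s^-1.
  have -> : (fun x : R => x / s) = s^-1 \*: (id : R -> R).
    by apply/funext => y /=; rewrite mulrC.
  have := is_deriveZ s^-1 (is_derive_id x (1 : R)).
  by rewrite /GRing.scale/= mulr1.
have h2 : is_derive (x/s) (1 : R) Phi (phi (x / s)) := is_derive_Phi (x / s).
have := @is_derive1_comp R Phi (fun x : R => x / s) x _ _ h2 h.
by rewrite mulrC.
Qed.

Lemma Phi_cvgNy_div s : 0 < s -> Phi (x / s) @[x --> -oo] --> (0 : R).
Proof.
move=> s0; apply: (@cvg_comp _ _ _ (fun x => x / s) Phi _ -oo).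
  by apply: gt0_cvgMlNy; [rewrite invr_gt0|exact: cvg_id].
exact: (@ncdf_cvgNy 1).
Qed.

(** Both sides have the same derivative, so their difference is constant, and it tends to 0 at
    [-oo]. *)
Lemma ncdf_scale s x : 0 < s -> ncdf s x = Phi (x / s).
Proof.
move=> s0.
pose g x := ncdf s x - Phi (x / s).
have gd (y : R) : is_derive y (1 : R) g 0.
  have h1 := @is_derive_ncdf R s y (lt0r_neq0 s0).
  have h2 := is_derive_Phi_div s y.
  by apply: is_derive_eq; rewrite normal_pdf_scale// subrr.
have gc y : g y = g 0 by apply: is_derive_0_is_cst.
have g0 : g y @[y --> -oo] --> (0 : R).
  rewrite -[0]subr0; apply: cvgB; [exact: ncdf_cvgNy|exact: Phi_cvgNy_div].
have g0' : g y @[y --> -oo] --> g 0.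
  rewrite (_ : g = cst (g 0)); first exact: cvg_cst.
  by apply/funext => y; rewrite gc.
apply/eqP; rewrite -subr_eq0 -/(g x) gc; apply/eqP.
exact: (cvg_unique _ g0' g0).
Qed.

Lemma phiN x : phi (- x) = phi x :> R.
Proof.
by rewrite /phi !normal_pdfE ?oner_eq0// /normal_fun !subr0 sqrrN.
Qed.

(** Since [phi] is even, [Phi x + Phi (- x)] has zero derivative; its constant value is its limit 1
    at [+oo]. *)
Lemma PhiN x : Phi (- x) = 1 - Phi x :> R.
Proof.
pose g x : R := Phi x + Phi (- x).
have gd (y : R) : is_derive y (1 : R) g 0.
  have h1 := is_derive_Phi y.
  have hN : is_derive y (1 : R) (fun x : R => - x) (-1) by apply: is_derive_eq.
  have h3 : is_derive (- y) (1 : R) Phi (phi (- y)) := is_derive_Phi (- y).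
  have h2 := @is_derive1_comp R Phi (fun x : R => - x) y _ _ h3 hN.
  by apply: is_derive_eq; rewrite phiN mulrN1 subrr.
have gc y : g y = g 0 by apply: is_derive_0_is_cst.
have g1 : g y @[y --> +oo] --> (1 : R).
  rewrite -[1]addr0; apply: cvgD; first exact: ncdf_cvgy.
  apply: (@cvg_comp _ _ _ (fun x : R => - x) Phi _ -oo); last exact: (@ncdf_cvgNy 1).
  by apply/(@cvgNrNy _ _ _ _ (id : R -> R)); exact: cvg_id.
have g1' : g y @[y --> +oo] --> g 0.
  rewrite (_ : g = cst (g 0)); first exact: cvg_cst.
  by apply/funext => y; rewrite gc.
have <- : g x = 1 by rewrite gc; exact: (cvg_unique _ g1' g1).
by rewrite /g addrC addKr.
Qed.
End normal_cdf_symmetry.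

Lemma ex_pushforward d d' (T : measurableType d) (U : measurableType d')
    (R : realType) (P : probability T R) (f : T -> U) :
  measurable_fun [set: T] f ->
  exists Q : probability U R, forall A, Q A = P (f @^-1` A).
Proof.
move=> mf.
pose X : {RV P >-> U} := @mfun_Sub _ _ _ _ f (mem_set mf).
by exists (distribution P X).
Qed.

Lemma ex_pushforward_measure d d' (T : measurableType d) (U : measurableType d')
    (R : realType) (m : {measure set T -> \bar R}) (f : T -> U) :
  measurable_fun [set: T] f ->
  exists nu : {measure set U -> \bar R}, forall A, nu A = m (f @^-1` A).
Proof.
move=> mf; unshelve eexists; first by exact: (pushforward m f).
by [].
Qed.

Section standard_normal.
Context {R : realType}.
Implicit Types x y s u v : R.

Lemma normal_prob_set1 s x : normal_prob 0 s [set x] = 0%E.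
Proof.
apply: (null_content_dominatesP _ _).1 (normal_prob_dominates 0 s) _ _ _.
  exact: measurable_set1.
exact: lebesgue_measure_set1.
Qed.

Lemma ncdfE_o s x : normal_prob 0 s `]-oo, x[ = (ncdf s x)%:E.
Proof.
rewrite -ncdfE (_ : `]-oo, x] = `]-oo, x[ `|` [set x])%classic.
  by rewrite measureU0//; exact: normal_prob_set1.
apply/seteqP; split => y /=; rewrite !in_itv/= le_eqVlt.
  by move=> /orP[/eqP|]; [right|left].
by move=> [->|->]; rewrite ?eqxx// orbT.
Qed.

(** Pushing forward by the identity moves the law from [measurableTypeR R] to [R], where the
    uniqueness and complement lemmas are applied. *)
Lemma ex_normal s : exists N : probability R R,
  forall A : set R, N A = normal_prob 0 s A.
Proof.
have mI : measurable_fun [set: measurableTypeR R] (idfun : _ -> R).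
  exact: measurable_id.
have [N NE] := ex_pushforward (normal_prob 0 s) mI.
by exists N; exact: NE.
Qed.

Lemma normal_probN s (A : set R) : 0 < s -> measurable A ->
  normal_prob 0 s (-%R @^-1` A) = normal_prob 0 s A.
Proof.
move=> s0 mA.
have [N NE] := ex_normal s.
have mN : measurable_fun [set: R] (-%R : R -> R) by exact: oppr_measurable.
have [Q QE] := ex_pushforward N mN.
rewrite -!NE -QE; apply: measureR_unique => //; last first.
  by move=> x; rewrite (le_lt_trans (probability_le1 _ _))// ?ltry.
move=> x; rewrite [LHS]QE.
have -> : (-%R @^-1` `]-oo, x] = ~` `]-oo, (- x)[ :> set R)%classic.
  apply/seteqP; split => y /=; rewrite !in_itv/= ?andbT lerNl.
    by move=> /le_gtF->.
  by move=> /negP; rewrite -leNgt.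
rewrite probability_setC// [RHS]NE NE ncdfE_o ncdfE !ncdf_scale// mulNr PhiN.
by rewrite -EFinB; congr _%:E; ring.
Qed.

Lemma Phi_lt : {homo (@Phi R) : x y / x < y}.
Proof.
move=> x y xy.
apply: (@gtr0_derive1_lt_cc R Phi x y) => //.
- by move=> z _; case: (is_derive_Phi z).
- move=> z _; have := is_derive_Phi z.
  move=> h; rewrite derive1E (@derive_val _ _ _ _ _ _ _ h).
  exact/normal_pdf_gt0/oner_neq0.
- by apply: continuous_subspaceT => z; exact: (ncdf_continuous (oner_neq0 R)).
- by rewrite in_itv/= lexx ltW.
- by rewrite in_itv/= lexx ltW.
Qed.

Lemma Phi_mono : {mono (@Phi R) : x y / x <= y}.
Proof. exact: le_mono Phi_lt. Qed.

Lemma Phi_ltmono : {mono (@Phi R) : x y / x < y}.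
Proof. exact: leW_mono Phi_mono. Qed.

Lemma Phi_continuous : continuous (@Phi R).
Proof. exact: ncdf_continuous (oner_neq0 R). Qed.

Lemma Phi_surj u : 0 < u < 1 -> exists x : R, Phi x = u.
Proof.
move=> /andP[u0 u1].
have [a au] : exists a : R, Phi a < u.
  have : \forall x \near -oo, Phi x < u by exact: cvgr_lt (@ncdf_cvgNy R 1) _ u0.
  by move=> /(@filter_ex _ _ _)[a]; exists a.
have [b bu] : exists b : R, u < Phi b.
  have : \forall x \near +oo, u < Phi x by exact: cvgr_gt (@ncdf_cvgy R 1) _ u1.
  by move=> /(@filter_ex _ _ _)[b]; exists b.
have ab : a <= b by rewrite -Phi_mono ltW// (lt_trans au).
have [|||c _ <-] := @IVT R Phi a b u => //; last by exists c.
  by apply: continuous_subspaceT => z; exact: Phi_continuous.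
by rewrite ge_min le_max (ltW au) (ltW bu) orbT.
Qed.

Lemma PhiK x : Phi_inv (Phi x) = x :> R.
Proof.
rewrite /Phi_inv /quantile.
have -> : [set y | Phi x <= Phi y] = `[x, +oo[%classic.
  by apply/seteqP; split => y /=; rewrite in_itv/= andbT Phi_mono.
exact: inf_itv.
Qed.

Lemma Phi_invK u : 0 < u < 1 -> Phi (Phi_inv u) = u :> R.
Proof. by move=> /Phi_surj[x <-]; rewrite PhiK. Qed.

Lemma Phi0 : Phi (0 : R) = 2^-1 :> R.
Proof. have := PhiN (0 : R); rewrite oppr0 => h; lra. Qed.

Lemma Phi_inv_is_derive u : 0 < u < 1 ->
  is_derive u (1 : R) (@Phi_inv R) (phi (Phi_inv u))^-1.
Proof.
move=> u01; rewrite -{1}(Phi_invK u01).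
apply: (@is_derive_inverse R Phi).
- by near=> z; exact: PhiK.
- by near=> z; exact: Phi_continuous.
- exact: is_derive_Phi.
- by rewrite gt_eqF// normal_pdf_gt0// oner_neq0.
Unshelve. all: by end_near. Qed.

Lemma is_derive_phi x : is_derive x (1 : R) (@phi R) (- x * phi x).
Proof.
rewrite /phi normal_pdfE ?oner_neq0// /normal_fun.
have h : is_derive x (1 : R) (fun x : R => - (x - 0) ^+ 2 / (1 ^+ 2 *+ 2)) (- x).
  have -> : (fun x : R => - (x - 0) ^+ 2 / (1 ^+ 2 *+ 2)) =
      (- 2^-1) \*: ((id : R -> R) ^+ 2).
    apply/funext => y; rewrite subr0 expr1n exprfctE.
    by rewrite mulrC mulrN -mulNr.
  have := is_deriveZ (- 2^-1) (is_deriveX 2 (is_derive_id x (1 : R))).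
  rewrite /GRing.scale/= mulr1 expr1 => h; apply: is_derive_eq.
  by field.
have := @is_derive1_comp R expR _ x _ _ (is_derive_expR _) h.
move=> /(is_deriveZ (normal_peak 1)) h2.
by apply: is_derive_eq; rewrite /GRing.scale/=; ring.
Qed.
End standard_normal.

(** * The reflection principle for symmetric random walks *)

(** Boxes are stable under intersection and generate the product sigma-algebra, so two laws that
    agree on them agree everywhere. This carries the product formula of independence over to events
    on whole trajectories. *)
Lemma eq_tuple_law d d' (T : measurableType d) (U : measurableType d')
    (R : realType) (P : probability T R) n (X Y : 'I_n -> T -> U) :
  (forall i, measurable_fun setT (X i)) ->
  (forall i, measurable_fun setT (Y i)) ->
  (forall B : 'I_n -> set U, (forall i, measurable (B i)) ->
    P (\bigcap_(i in [set: 'I_n]) (X i @^-1` B i)) =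
    P (\bigcap_(i in [set: 'I_n]) (Y i @^-1` B i))) ->
  forall E : set (n.-tuple U), measurable E ->
    P ((fun w => [tuple X i w | i < n]) @^-1` E) =
    P ((fun w => [tuple Y i w | i < n]) @^-1` E).
Proof.
move=> mX mY XY E mE.
have mt (Z : 'I_n -> T -> U) : (forall i, measurable_fun setT (Z i)) ->
    measurable_fun setT (fun w => [tuple Z i w | i < n]).
  move=> mZ; apply/measurable_fun_tnthP => i.
  by rewrite (_ : _ \o _ = Z i)//; apply/funext => w /=; rewrite tnth_mktuple.
have [PX PXE] := ex_pushforward P (mt _ mX).
have [PY PYE] := ex_pushforward P (mt _ mY).
rewrite -PXE -PYE.
pose G := [set A : set (n.-tuple U) | exists B : 'I_n -> set U,
  (forall i, measurable (B i)) /\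
  A = \bigcap_(i in [set: 'I_n]) ((@tnth _ U ^~ i) @^-1` B i)].
have GT : G setT.
  exists (fun=> setT); split => //.
  by apply/seteqP; split => // y _ i _.
have mG A : G A -> measurable A.
  move=> [B [mB ->]]; apply: fin_bigcap_measurable => // i _.
  by rewrite -[X in measurable X]setTI; apply: (@measurable_tnth _ U n i).
apply: (measure_unique G (fun=> setT)) => //.
- rewrite eqEsubset; split; last first.
    by apply: smallest_sub => //; exact: sigma_algebra_measurable.
  apply: smallest_sub; first exact: smallest_sigma_algebra.
  move=> A; rewrite -bigcup_seq => -[i _ [B mB <-]].
  apply: sub_sigma_algebra.
  exists (fun j => if j == i then B else setT); split.
    by move=> j; case: ifP.
  rewrite setTI; apply/seteqP; split => y /=.
    by move=> Bi j _ /=; case: eqP => // ->.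
  by move=> /(_ i I) /=; rewrite eqxx.
- move=> _ _ [B [mB ->]] [B' [mB' ->]].
  exists (fun i => B i `&` B' i); split.
    by move=> i; exact: measurableI.
  by rewrite -bigcapI.
- by rewrite bigcup_const.
- move=> _ [B [mB ->]].
  have e (Z : 'I_n -> T -> U) :
      (fun w => [tuple Z i w | i < n]) @^-1`
        (\bigcap_(i in [set: 'I_n]) ((@tnth _ U ^~ i) @^-1` B i)) =
      \bigcap_(i in [set: 'I_n]) (Z i @^-1` B i).
    by apply/seteqP; split => w /= h i _; have /= := h i I; rewrite tnth_mktuple.
  by rewrite [LHS]PXE [RHS]PYE !e XY.
- by move=> _; rewrite (le_lt_trans (probability_le1 _ _))// ?ltry.
Qed.

Section reflection.
Context d (T : measurableType d) (R : realType) (P : probability T R).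
Variables (X : nat -> T -> R) (n : nat).
Hypothesis mX : forall i, measurable_fun setT (X i).
Hypothesis indepX : mutually_independent P (fun i : 'I_n => X i).
Hypothesis symX : forall i (A : set R), (i < n)%N -> measurable A ->
  P (X i @^-1` (-%R @^-1` A)) = P (X i @^-1` A).

Let S k w := \sum_(0 <= i < k) X i w.

Let flip k i w := if (i < k)%N then X i w else - X i w.

Let mflip k i : measurable_fun setT (flip k i).
Proof.
rewrite /flip; case: (i < k)%N => //.
by apply: measurableT_comp => //; exact: oppr_measurable.
Qed.

Let mS k : measurable_fun setT (S k).
Proof. by rewrite /S; apply: (@measurable_sum _ _ R setT nat _ X). Qed.

(** Reversing the sign of a step replaces its side [B i] of a box by the mirror image, which is
    equally likely by symmetry; independence then writes both box probabilities as the same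
    product. *)
Lemma eq_flip_law k (E : set (n.-tuple R)) : measurable E ->
  P ((fun w => [tuple X i w | i < n]) @^-1` E) =
  P ((fun w => [tuple flip k i w | i < n]) @^-1` E).
Proof.
move=> mE; apply: eq_tuple_law => //.
move=> B mB; rewrite indepX//.
pose B' (i : 'I_n) := if (i < k)%N then B i else -%R @^-1` B i.
have mB' i : measurable (B' i).
  rewrite /B'; case: ifP => // _.
  by rewrite -[X in measurable X]setTI; exact: (@oppr_measurable R).
have -> : \bigcap_(i in [set: 'I_n]) (flip k i @^-1` B i) =
          \bigcap_(i in [set: 'I_n]) (X i @^-1` B' i).
  apply: eq_bigcapr => i _; rewrite /flip /B' /preimage.
  by apply/funext => w /=; case: ifP.
rewrite indepX//; apply: eq_bigr => i _; rewrite /B'; case: ifP => // _.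
by rewrite symX.
Qed.

(** The first passage above [m] occurs at [k]. Only the steps of index below [k] matter, and
    [flip k] leaves these unchanged. *)
Let hit m k : set T := [set w | m < S k w /\ forall j, (j < k)%N -> S j w <= m].

Let mhit m k : measurable (hit m k).
Proof.
have -> : hit m k =
    [set w | m < S k w] `&` \bigcap_(j in `I_k) [set w | S j w <= m].
  by apply/seteqP; split => w.
apply: measurableI.
  by rewrite -[X in measurable X]setTI; exact: measurable_fun_ltr.
apply: bigcap_measurableType => j _.
by rewrite -[X in measurable X]setTI; exact: measurable_fun_ler.
Qed.

Lemma hit_split m (F : set T) : measurable F ->
  P ([set w | exists2 k, (k <= n)%N & m < S k w] `&` F) =
  (\sum_(k < n.+1) P (hit m k `&` F))%E.
Proof.
move=> mF; rewrite -(measure_bigsetU P (F := fun k => hit m k `&` F)).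
- congr (P _); rewrite -big_distrl/= -bigcup_mkord; congr (_ `&` _).
  apply/seteqP; split => w /=.
    move=> [k kn mk].
    have ex : exists k, m < S k w by exists k.
    case: (ex_minnP ex) => j mj minj.
    exists j => /=; first by rewrite ltnS (leq_trans (minj _ mk)).
    split => // i ij; rewrite leNgt; apply/negP => /minj.
    by rewrite leqNgt ij.
  by move=> [k /= kn [mk _]]; exists k.
- by move=> k; exact: measurableI.
- apply/trivIsetP => i j _ _; rewrite neq_lt => ij.
  apply/seteqP; split => // w [[[hi1 hi2] _] [[hj1 hj2] _]].
  case/orP: ij => [/hj2|/hi2]; first by rewrite leNgt hi1.
  by rewrite leNgt hj1.
Qed.

Lemma hit_flip m x k : (k <= n)%N ->
  P (hit m k `&` [set w | S n w <= x]) =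
  P (hit m k `&` [set w | 2 * S k w - S n w <= x]).
Proof.
move=> kn.
(* Both events are preimages of a single set [E] of trajectories, one under the steps and the other
   under the flipped steps; [p j] is the partial sum read off the tuple. *)
pose p j (y : n.-tuple R) := \sum_(0 <= i < j) y`_i.
have mp j : measurable_fun setT (p j).
  apply: (@measurable_sum _ _ R setT nat _
    (fun i (y : n.-tuple R) => y`_i)) => i.
  have [ni|ni] := leqP n i.
    rewrite (_ : (fun _ => _) = cst 0)//.
    by apply/funext => y; rewrite nth_default// size_tuple.
  rewrite (_ : (fun _ => _) = (@tnth _ R ^~ (Ordinal ni))).
    exact: measurable_tnth.
  by apply/funext => y; rewrite (tnth_nth 0).
pose E : set (n.-tuple R) := [set y | m < p k y] `&`
  (\bigcap_(j in `I_k) [set y | p j y <= m]) `&` [set y | p n y <= x].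
have mE : measurable E.
  apply: measurableI; first apply: measurableI.
  - by rewrite -[X in measurable X]setTI; exact: measurable_fun_ltr.
  - apply: bigcap_measurableType => j _.
    by rewrite -[X in measurable X]setTI; exact: measurable_fun_ler.
  - by rewrite -[X in measurable X]setTI; exact: measurable_fun_ler.
have pE (Z : nat -> T -> R) j w : (j <= n)%N ->
    p j [tuple Z i w | i < n] = \sum_(0 <= i < j) Z i w.
  move=> jn; apply: eq_big_nat => i /andP[_ ij].
  have ni : (i < n)%N by exact: leq_trans jn.
  by rewrite -(tnth_nth 0 _ (Ordinal ni)) tnth_mktuple.
have fS j w : (j <= k)%N -> \sum_(0 <= i < j) flip k i w = S j w.
  by move=> jk; apply: eq_big_nat => i /andP[_ ij]; rewrite /flip (leq_trans ij).
have fSn w : \sum_(0 <= i < n) flip k i w = 2 * S k w - S n w.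
  rewrite /S (@big_cat_nat _ _ _ k 0 n)//=.
  rewrite [in RHS](@big_cat_nat _ _ _ k 0 n)//= fS//.
  rewrite (_ : \sum_(k <= i < n) flip k i w = - \sum_(k <= i < n) X i w).
  rewrite /S; set a := \sum_(0 <= i < k) _; set b := \sum_(k <= i < n) _; ring.
  rewrite -sumrN; apply: eq_big_nat => i /andP[ki _].
  by rewrite /flip ltnNge ki.
transitivity (P ((fun w => [tuple X i w | i < n]) @^-1` E)).
  congr (P _); apply/seteqP; split => w /=.
    move=> [[h1 h2] h3]; rewrite /E/= !pE//; split => //; split => // j /= jk.
    by rewrite pE ?h2// ltnW// (leq_trans jk).
  rewrite /E/= !pE// => -[[h1 h2] h3]; split => //; split => // j jk.
  by have /= := h2 j jk; rewrite pE// ltnW// (leq_trans jk).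
rewrite (eq_flip_law k)//.
congr (P _); apply/seteqP; split => w /=.
  rewrite /E/= !pE// fSn fS// => -[[h1 h2] h3]; split => //; split => // j jk.
  by have /= := h2 j jk; rewrite pE ?fS// ltnW// (leq_trans jk).
move=> [[h1 h2] h3]; rewrite /E/= !pE// fSn fS//; split => //; split => // j /= jk.
by rewrite pE ?fS ?h2// ltnW// (leq_trans jk).
Qed.

(** At the passage [m < S k], so [2 * S k - S n <= x] forces [2 * m - x < S n]. The pieces are then
    summed back over [k]. *)
Lemma reflection_upper (m x : R) :
  (P ([set w | exists2 k, (k <= n)%N & (m < S k w)%R] `&`
      [set w | (S n w <= x)%R]) <=
   P [set w | (2 * m - x < S n w)%R])%E.
Proof.
have mle (f : T -> R) a : measurable_fun setT f -> measurable [set w | f w <= a].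
  by move=> mf; rewrite -[X in measurable X]setTI; exact: measurable_fun_ler.
have mlt (f : T -> R) a : measurable_fun setT f -> measurable [set w | a < f w].
  by move=> mf; rewrite -[X in measurable X]setTI; exact: measurable_fun_ltr.
rewrite hit_split; last exact: mle.
apply: (@le_trans _ _ (\sum_(k < n.+1)
    P (hit m k `&` [set w | (2 * m - x < S n w)%R]))%E).
  apply: lee_sum => k _; rewrite hit_flip//; last by rewrite -ltnS.
  apply: le_measure; rewrite ?inE.
  - apply: measurableI => //; apply: mle; apply: measurable_funB => //.
    exact: measurable_funM.
  - by apply: measurableI => //; apply: mlt.
  - by move=> w [[h1 h2] /= h3]; split => //=; lra.
rewrite -hit_split; last exact: mlt.
apply: le_measure; rewrite ?inE.
- apply: measurableI; last exact: mlt.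
  have -> : [set w | exists2 k, (k <= n)%N & m < S k w] =
    \bigcup_(k in [set k | (k <= n)%N]) [set w | m < S k w].
    by apply/seteqP; split => w /=.
  by apply: bigcup_measurable => k _; exact: mlt.
- exact: mlt.
- by move=> w [].
Qed.

(** When no step exceeds [e], the walk satisfies [S k <= m + e] at its first passage, so
    [2 * (m + e) - x <= S n] gives [2 * S k - S n <= x]. *)
Lemma reflection_lower (m x e : R) : 0 <= m -> x <= m -> 0 < e ->
  (P [set w | (2 * (m + e) - x <= S n w)%R /\
               forall i, (i < n)%N -> (X i w <= e)%R] <=
   P ([set w | exists2 k, (k <= n)%N & (m < S k w)%R] `&`
      [set w | (S n w <= x)%R]))%E.
Proof.
move=> m0 xm e0.
have mle (f : T -> R) a : measurable_fun setT f -> measurable [set w | f w <= a].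
  by move=> mf; rewrite -[X in measurable X]setTI; exact: measurable_fun_ler.
have mge (f : T -> R) a : measurable_fun setT f -> measurable [set w | a <= f w].
  by move=> mf; rewrite -[X in measurable X]setTI; exact: measurable_fun_ler.
set G := [set w | _ /\ _].
have mG : measurable G.
  have -> : G = [set w | 2 * (m + e) - x <= S n w] `&`
      \bigcap_(j in `I_n) [set w | X j w <= e].
    by apply/seteqP; split => w.
  apply: measurableI; first exact: mge.
  by apply: bigcap_measurableType => j _; exact: mle.
(* As [x <= m] and [0 < e], the final value is at least [2 * (m + e) - x > m]: the walk has exceeded
   [m] by time [n]. *)
have -> : G = [set w | exists2 k, (k <= n)%N & m < S k w] `&` G.
  apply/esym/setIidr => w [h _]; exists n => //=; lra.
rewrite hit_split// hit_split; last exact: mle.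
apply: lee_sum => k _.
have kn : (k <= n)%N by rewrite -ltnS.
rewrite hit_flip//.
apply: le_measure; rewrite ?inE.
- exact: measurableI.
- apply: measurableI => //; apply: mle; apply: measurable_funB => //.
  exact: measurable_funM.
move=> w [[h1 h2] [h3 h4]]; split => //=.
suff : S k w <= m + e by lra.
case: (nat_of_ord k) => [|j] in kn h1 h2 *.
  by rewrite /S big_geq//; lra.
rewrite /S big_nat_recr//= -/(S j w).
by apply: lerD; [exact: h2|exact: h4].
Qed.

End reflection.

(** * Passage to the limit *)

Section ae_measure.
Context d (T : measurableType d) (R : realType) (P : probability T R).

Lemma le_measure_ae (A B : set T) : measurable A -> measurable B ->
  {ae P, forall w, A w -> B w} -> (P A <= P B)%E.
Proof.
move=> mA mB [N [mN N0 ABN]].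
rewrite -(measureU0 mB mN N0); apply: le_measure; rewrite ?inE//.
  exact: measurableU.
move=> w Aw; have [Bw|nBw] := pselect (B w); first by left.
by right; apply: ABN => /= /(_ Aw).
Qed.

Lemma eq_measure_ae (A B : set T) : measurable A -> measurable B ->
  {ae P, forall w, A w <-> B w} -> P A = P B.
Proof.
move=> mA mB AB; apply/eqP; rewrite eq_le !le_measure_ae//.
  by apply: filterS AB => w [].
by apply: filterS AB => w [].
Qed.

(** Fatou's lemma for events: up to a null set, [A] lies in the lower limit of [Q], the increasing
    union of the events [B n], each of which is contained in [Q n]. *)
Lemma measure_eventually_le (A : set T) (Q : nat -> set T) (c : \bar R) :
  measurable A -> (forall n, measurable (Q n)) -> (forall n, (P (Q n) <= c)%E) ->
  {ae P, forall w, A w -> \forall n \near \oo, Q n w} -> (P A <= c)%E.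
Proof.
move=> mA mQ Qc AQ.
pose B n := \bigcap_(k in [set k | (n <= k)%N]) Q k.
have mB n : measurable (B n) by apply: bigcap_measurableType.
have mUB : measurable (\bigcup_n B n) by exact: bigcupT_measurable.
apply: (@le_trans _ _ (P (\bigcup_n B n))).
  apply: le_measure_ae => //; apply: filterS AQ => w h /h.
have cvgB : P (B n) @[n --> \oo] --> P (\bigcup_n B n).
  apply: nondecreasing_cvg_mu => //.
  move=> i j ij; apply/subsetPset => w Bw k /= jk.
  by apply: Bw => /=; exact: leq_trans jk.
rewrite -(cvg_lim _ cvgB)//; apply: lime_le.
  by apply/cvg_ex; eexists; exact: cvgB.
near=> n; apply: (le_trans _ (Qc n)); apply: le_measure; rewrite ?inE//.
by move=> w; apply => /=.
Unshelve. all: by end_near. Qed.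

End ae_measure.

Lemma unif_continuous_segment (R : realType) (f : R -> R) (t e : R) :
  {within `[0, +oo[, continuous f} -> 0 < e ->
  exists2 r : R, 0 < r & forall x y, 0 <= x <= t -> 0 <= y <= t ->
    `|x - y| < r -> `|f x - f y| < e.
Proof.
move=> cf e0.
(* Compactness in near-covering form, with the radii tending to [0] from the right as the auxiliary
   filter: a radius valid near each point becomes valid on the whole segment. *)
have /compact_near_coveringP/near_covering_withinP := @segment_compact R 0 t.
move=> /(_ R (0^'+) (fun r x => forall y, 0 <= y <= t -> `|x - y| < r ->
  `|f x - f y| < e)).
move=> /(_ _)[].
  move=> x /=; rewrite in_itv/= => /andP[x0 xt].
  have /subspace_continuousP/(_ x) := cf.
  rewrite /= in_itv/= andbT => /(_ x0).
  move=> /cvgrPdist_lt/(_ (e / 2)); rewrite divr_gt0// => /(_ isT).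
  rewrite near_withinE => -[r /= r0 fr].
  have r20 : 0 < r / 2 by rewrite divr_gt0.
  (* Halving keeps both [x'] and [y] within [r] of the centre [x], where [f] varies by less than
     [e / 2]. *)
  exists (ball x (r / 2), `]0, r / 2[%classic) => /=.
    split; first exact: nbhsx_ballx.
    exists (r / 2) => //= z /=.
    by rewrite sub0r normrN in_itv/= => /ltr_normlW -> ->.
  move=> [x' r'] [/= xx' ]; rewrite in_itv/= => /andP[r'0 r'r].
  rewrite in_itv/= => /andP[x'0 x't] y /andP[y0 yt] x'y.
  have h1 : `|f x - f x'| < e / 2.
    apply: fr => /=; last by rewrite in_itv/= x'0.
    by rewrite (lt_trans xx')// ltr_pdivrMr// ltr_pMr// ltr1n.
  have h2 : `|f x - f y| < e / 2.
    apply: fr => /=; last by rewrite in_itv/= y0.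
    rewrite (le_lt_trans (ler_distD x' _ _))// [ltRHS](splitr r) ltrD//.
    by rewrite (lt_trans x'y).
  rewrite (le_lt_trans (ler_distD (f x) _ _))// [ltRHS](splitr e) ltrD//.
  by rewrite distrC.
move=> r /= r0 h; exists (r / 2); first by rewrite divr_gt0.
move=> x y xt yt xy; apply: (h (r / 2)) => //=.
- rewrite sub0r normrN gtr0_norm ?divr_gt0//.
  by rewrite ltr_pdivrMr// ltr_pMr// ltr1n.
- by rewrite divr_gt0.
Qed.

(** * Joint law of Brownian motion and its running maximum *)

Section brownian_maximum.
Context d (T : measurableType d) (R : realType) (P : probability T R).
Variables (W : R -> {RV P >-> R}) (t : R) (M : {RV P >-> R}).
Hypotheses (bmW : standard_brownian_motion W) (t0 : 0 < t)
  (maxM : running_max W t M).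

(** The denominator [n.+1] makes every [n] give a genuine subdivision of [[0, t]], with [n.+1]
    steps. *)
Let grid n i : R := t * i%:R / n.+1%:R.

Let step n i : T -> R := increment W (grid n i) (grid n i.+1).

Let mstep n i : measurable_fun setT (step n i).
Proof. by apply: measurable_funB. Qed.

Let grid0 n : grid n 0 = 0. Proof. by rewrite /grid mulr0 mul0r. Qed.

Let gridn n : grid n n.+1 = t.
Proof. by rewrite /grid mulfK// pnatr_eq0. Qed.

Let gridS n i : grid n i.+1 = grid n i + t / n.+1%:R.
Proof. by rewrite /grid -addn1 natrD; ring. Qed.

Let grid_itv n i : (i <= n.+1)%N -> 0 <= grid n i <= t.
Proof.
move=> i_n; apply/andP; split; first by rewrite /grid divr_ge0// mulr_ge0// ltW.
by rewrite /grid ler_pdivrMr ?ltr0n// ler_pM2l// ler_nat.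
Qed.

(** The term [W 0 w] stays because it vanishes only almost surely; it is removed inside the almost
    sure arguments. *)
Let stepS n k w : \sum_(0 <= i < k) step n i w = W (grid n k) w - W 0 w.
Proof.
rewrite (eq_bigr (fun i => W (grid n i.+1) w - W (grid n i) w)) => [|//].
by rewrite telescope_sumr// grid0.
Qed.

Let sqrt_t0 : 0 < Num.sqrt t. Proof. by rewrite sqrtr_gt0. Qed.

Let indep_step n : mutually_independent P (fun i : 'I_n.+1 => step n i).
Proof.
have [_ + _ _] := bmW; apply; first by rewrite grid0.
by move=> i; rewrite gridS lerDl divr_ge0// ltW.
Qed.

Let sym_step n i (A : set R) : (i < n.+1)%N -> measurable A ->
  P (step n i @^-1` (-%R @^-1` A)) = P (step n i @^-1` A).
Proof.
move=> i_n mA; have [_ _ law _] := bmW.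
have g0 : 0 <= grid n i by have /andP[] := grid_itv (ltnW i_n).
have gg : grid n i < grid n i.+1 by rewrite gridS ltrDl divr_gt0.
rewrite !law// ?normal_probN//; first by rewrite sqrtr_gt0 subr_gt0.
by rewrite -[X in measurable X]setTI; exact: (@oppr_measurable R).
Qed.

Lemma bm_marginal x : P [set w | x < W t w - W 0 w] = (1 - Phi (x / Num.sqrt t))%:E.
Proof.
have [_ _ law _] := bmW.
have := law 0 t (lexx _) t0 `]x, +oo[%classic (measurable_itv _).
rewrite subr0 => h.
transitivity (P (increment W 0 t @^-1` `]x, +oo[)).
  by congr (P _); apply/seteqP; split => w /=; rewrite in_itv/= andbT.
have [N NE] := ex_normal (Num.sqrt t).
rewrite h -NE -setCitvl probability_setC// NE ncdfE.
by rewrite ncdf_scale// sqrtr_gt0.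
Qed.

Let mle (f : T -> R) a : measurable_fun setT f -> measurable [set w | f w <= a].
Proof.
by move=> mf; rewrite -[X in measurable X]setTI; exact: measurable_fun_ler.
Qed.

Let mlt (f : T -> R) a : measurable_fun setT f -> measurable [set w | a < f w].
Proof.
by move=> mf; rewrite -[X in measurable X]setTI; exact: measurable_fun_ltr.
Qed.

Let msum n k : measurable_fun setT (fun w => \sum_(0 <= i < k) step n i w).
Proof. exact: (@measurable_sum _ _ R setT nat _ (step n)). Qed.

Let exceed n m := [set w | exists2 k, (k <= n.+1)%N &
  m < \sum_(0 <= i < k) step n i w].

Let mexceed n m : measurable (exceed n m).
Proof.
have -> : exceed n m = \bigcup_(k in [set k | (k <= n.+1)%N])
    [set w | m < \sum_(0 <= i < k) step n i w].
  by apply/seteqP; split => w /=.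
by apply: bigcup_measurable => k _; exact: mlt.
Qed.

Let bm_ae : {ae P, forall w, [/\ W 0 w = 0,
  {within `[0, +oo[, continuous (fun t => W t w)},
  (exists2 s, 0 <= s <= t & W s w = M w) &
  forall s, 0 <= s <= t -> W s w <= M w]}.
Proof.
have [W0 _ _ Wc] := bmW.
apply: filterS3 W0 Wc maxM => w w0 wc [[s /=]].
rewrite in_itv/= => s0t sM ub; split => //; first by exists s.
by move=> s' s't; apply: ub => /=; exists s' => //=; rewrite in_itv.
Qed.

Let near_mesh (r : R) : 0 < r -> \forall n \near \oo, t / n.+1%:R < r.
Proof.
move=> r0; have rt : 0 < r / t by rewrite divr_gt0.
have := near_infty_natSinv_lt (PosNum rt).
apply: filterS => n /=.
by rewrite ltr_pdivlMr// mulrC.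
Qed.

(** If the maximum, attained at [s], exceeds [m], then by continuity so does the value at the last
    grid point before [s] once the mesh is small. The grid event thus eventually holds, and
    [reflection_upper] bounds it uniformly in [n]. *)
Lemma max_gt_le m x :
  (P ([set w | (m < M w)%R] `&` [set w | (W t w <= x)%R]) <=
  (1 - Phi ((2 * m - x) / Num.sqrt t))%:E)%E.
Proof.
apply: (@measure_eventually_le _ _ _ _ _
  (fun n => exceed n m `&` [set w | \sum_(0 <= i < n.+1) step n i w <= x])).
- by apply: measurableI; [exact: mlt|exact: mle].
- by move=> n; apply: measurableI; [exact: mexceed|exact: mle].
- move=> n.
  apply: le_trans (@reflection_upper _ _ _ P (step n) n.+1 (mstep n)
    (indep_step (n:=n)) (sym_step (n:=n)) m x) _.
  by under eq_set do rewrite stepS gridn; rewrite bm_marginal.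
- apply: filterS bm_ae => w [w0 wc [s /andP[s0 st] sM] ub] [/= mM Wx].
  (* The gap [M w - m] is the tolerance for uniform continuity, hence depends on the path; so does
     the mesh from which the grid event holds. *)
  have Mm0 : 0 < M w - m by rewrite subr_gt0.
  have [r r0 hr] := @unif_continuous_segment R (fun t => W t w) t _ wc Mm0.
  apply: filterS (near_mesh r0) => n tn.
  split; last by rewrite /= stepS gridn w0 subr0.
  (* Index of the last grid point at or before [s]; it equals [n.+1] when [s = t]. *)
  pose k := Num.truncn (s * n.+1%:R / t).
  have sn0 : 0 <= s * n.+1%:R / t by rewrite divr_ge0 ?mulr_ge0// ltW.
  have /andP[k1 k2] := Num.Theory.truncn_itv sn0.
  rewrite -/k ler_pdivlMr// in k1; rewrite -/k ltr_pdivrMr// in k2.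
  have n0 : (0 : R) < n.+1%:R by rewrite ltr0n.
  have gk : grid n k <= s by rewrite /grid ler_pdivrMr// mulrC.
  have gk1 : s < grid n k.+1 by rewrite /grid ltr_pdivlMr// [ltRHS]mulrC.
  have kn : (k <= n.+1)%N.
    by rewrite -(ler_nat R) -(ler_pM2r t0) (le_trans k1)// mulrC ler_pM2l.
  exists k => //; rewrite stepS w0 subr0.
  have := hr s (grid n k); rewrite s0 st => /(_ isT (grid_itv kn)).
  rewrite ger0_norm ?subr_ge0// => /(_ _).
  have -> : s - grid n k < r by rewrite (lt_trans _ tn)// ltrBlDl -gridS.
  move=> /(_ isT); rewrite sM => /ltr_normlW; lra.
Qed.

(** By uniform continuity all steps are eventually at most [e], so [reflection_lower] applies on
    fine grids; a grid value above [m] then puts the maximum above [m]. *)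
Lemma max_gt_ge m x e : 0 <= m -> x <= m -> 0 < e ->
  ((1 - Phi ((2 * (m + e) - x) / Num.sqrt t))%:E <=
   P ([set w | (m < M w)%R] `&` [set w | (W t w <= x)%R]))%E.
Proof.
move=> m0 xm e0; rewrite -bm_marginal.
apply: (@measure_eventually_le _ _ _ _ _ (fun n =>
  [set w | 2 * (m + e) - x <= \sum_(0 <= i < n.+1) step n i w /\
           forall i, (i < n.+1)%N -> step n i w <= e])).
- by apply: (@mlt (W t \- W 0)); exact: measurable_funB.
- move=> n.
  rewrite (_ : mkset _ = [set w | 2 * (m + e) - x <= \sum_(0 <= i < n.+1) step n i w]
    `&` \bigcap_(i in `I_n.+1) [set w | step n i w <= e]); last first.
    by apply/seteqP; split.
  apply: measurableI.
    by rewrite -[X in measurable X]setTI; exact: measurable_fun_ler.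
  by apply: bigcap_measurableType => i _; exact: mle.
- move=> n.
  apply: le_trans (@reflection_lower _ _ _ P (step n) n.+1 (mstep n)
    (indep_step (n:=n)) (sym_step (n:=n)) m x e m0 xm e0) _.
  apply: le_measure_ae.
  + by apply: measurableI; [exact: mexceed|exact: mle].
  + by apply: measurableI; [exact: mlt|exact: mle].
  + apply: filterS bm_ae => w [w0 wc _ ub] [[k kn]].
    rewrite stepS w0 subr0 => mk /=; rewrite stepS gridn w0 subr0 => Wx.
    split => //=.
    by rewrite (lt_le_trans mk)// ub// grid_itv.
- apply: filterS bm_ae => w [w0 wc _ ub] /= Wx.
  have [r r0 hr] := @unif_continuous_segment R (fun t => W t w) t e wc e0.
  apply: filterS (near_mesh r0) => n tn /=; split; first by rewrite stepS gridn ltW.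
  move=> i i_n; apply: ltW.
  have := hr (grid n i.+1) (grid n i) (grid_itv i_n) (grid_itv (ltnW i_n)).
  rewrite gridS addrC addKr gtr0_norm ?divr_gt0// => /(_ tn) /ltr_normlW.
  by rewrite -gridS.
Qed.

Lemma bm_cdf x : P [set w | W t w <= x] = (Phi (x / Num.sqrt t))%:E.
Proof.
have mx : measurable [set w | x < W t w - W 0 w].
  by apply: (@mlt (W t \- W 0)); exact: measurable_funB.
rewrite (@eq_measure_ae _ _ _ P _ (~` [set w | x < W t w - W 0 w])).
- by rewrite probability_setC// bm_marginal -EFinB opprB addrC subrK.
- exact: mle.
- exact: measurableC.
- apply: filterS bm_ae => w [w0 _ _ _]; rewrite /= w0 subr0.
  by split=> [|/negP]; [move=> /le_gtF ->|rewrite -leNgt].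
Qed.

Lemma max_gt_joint m x : 0 <= m -> x <= m ->
  P ([set w | (m < M w)%R] `&` [set w | (W t w <= x)%R]) =
  (1 - Phi ((2 * m - x) / Num.sqrt t))%:E.
Proof.
move=> m0 xm; apply/eqP; rewrite eq_le max_gt_le/=.
have mI : measurable ([set w | (m < M w)%R] `&` [set w | (W t w <= x)%R]).
  by apply: measurableI; [exact: mlt|exact: mle].
(* A probability below [f 0], the limit of the lower bounds as [e] decreases to 0, would lie below
   [f e] for some [e > 0], against [max_gt_ge]. *)
rewrite -(fineK (fin_num_measure P _ mI)) lee_fin leNgt; apply/negP => h.
pose f e : R := 1 - Phi ((2 * (m + e) - x) / Num.sqrt t).
have f0 : f e @[e --> 0] --> f 0.
  apply: cvgB; first exact: cvg_cst.
  apply: (@cvg_comp _ _ _ (fun e => (2 * (m + e) - x) / Num.sqrt t) Phi);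
    last exact: Phi_continuous.
  apply: cvgM; last exact: cvg_cst.
  apply: cvgB; last exact: cvg_cst.
  apply: cvgM; first exact: cvg_cst.
  by apply: cvgD; [exact: cvg_cst|exact: cvg_id].
have {}f0 := cvg_at_right_filter f0.
have : \forall e \near 0^'+, 0 < e /\
    fine (P ([set w | (m < M w)%R] `&` [set w | (W t w <= x)%R])) < f e.
  near=> e; split => //.
  near: e; apply: (cvgr_gt _ f0).
  by rewrite /f addr0.
move=> /(@filter_ex _ _ _)[e [e0]].
by rewrite ltNge -lee_fin fineK ?fin_num_measure// max_gt_ge.
Unshelve. all: by end_near. Qed.

(** Since [W t <= M] almost surely, [x] may be lowered to [Num.min x m], which is in the range of
    [max_gt_joint]; the event is then the complement of [m < M] inside [W t <= y]. For [m < 0] it is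
    null because [M >= W 0 = 0]. *)
Lemma bm_max_cdf x m : P [set w | W t w <= x /\ M w <= m] =
  (if 0 <= m then
     Phi (Num.min x m / Num.sqrt t) - Phi ((Num.min x m - 2 * m) / Num.sqrt t)
   else 0)%:E.
Proof.
have mWM : measurable [set w | W t w <= x /\ M w <= m].
  by apply: measurableI; exact: mle.
case: ifPn => m0; last first.
  transitivity (P set0); last by rewrite measure0.
  apply: eq_measure_ae => //.
  apply: filterS bm_ae => w [w0 _ _ ub]; split => //= -[_ Mm].
  have := ub 0; rewrite lexx ltW// => /(_ isT); rewrite w0 => M0.
  by move/negP: m0; apply; exact: le_trans M0 Mm.
set y := Num.min x m.
have ym : y <= m by rewrite /y ge_min lexx orbT.
have mWyM : measurable [set w | W t w <= y /\ M w <= m].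
  by apply: measurableI; exact: mle.
rewrite (@eq_measure_ae _ _ _ P _ [set w | W t w <= y /\ M w <= m])//; last first.
  apply: filterS bm_ae => w [w0 _ _ ub] /=; rewrite /y le_min; split.
    move=> [-> Mm]; split => //=; apply: le_trans (ub t _) Mm.
    by rewrite lexx ltW.
  by move=> [/andP[-> _] ->].
have := bm_cdf y.
have -> : [set w | W t w <= y] = [set w | W t w <= y /\ M w <= m] `|`
    ([set w | m < M w] `&` [set w | W t w <= y]).
  apply/seteqP; split => w /=; last by move=> [[]|[]].
  by move=> Wy; case: (leP (M w) m) => h; [left|right].
rewrite measureU//; first last.
- by apply/seteqP; split => // w [[_ /= h1]] [/= h2 _]; move: h1; rewrite leNgt h2.
- by apply: measurableI; [exact: mlt|exact: mle].
rewrite [X in (_ + X)%E](max_gt_joint m0 ym).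
rewrite -(fineK (fin_num_measure P _ mWyM)) -EFinD => -[h].
rewrite -[LHS](fineK (fin_num_measure P _ mWyM)); congr _%:E.
have e : Phi ((y - 2 * m) / Num.sqrt t) = 1 - Phi ((2 * m - y) / Num.sqrt t).
  by rewrite -PhiN; congr Phi; ring.
by rewrite e -h addrK.
Qed.

(** The joint formula at [x = m] gives [2 * Phi (m / sqrt t) - 1], which is negative exactly when
    [m < 0], so the maximum with 0 covers both signs. *)
Lemma max_cdf m : P [set w | M w <= m] =
  (Num.max 0 (2 * Phi (m / Num.sqrt t) - 1))%:E.
Proof.
rewrite (@eq_measure_ae _ _ _ P _ [set w | W t w <= m /\ M w <= m]); last first.
- apply: filterS bm_ae => w [w0 _ _ ub] /=; split => [Mm|[]//]; split => //.
  by apply: le_trans (ub t _) Mm; rewrite lexx ltW.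
- by apply: measurableI; exact: mle.
- exact: mle.
rewrite bm_max_cdf minxx; congr _%:E; case: ifPn => m0.
  have -> : (m - 2 * m) / Num.sqrt t = - (m / Num.sqrt t) by ring.
  rewrite PhiN; set p := Phi _.
  suff : 2^-1 <= p by move=> h; rewrite max_r; lra.
  by rewrite -Phi0 Phi_mono divr_ge0// ltW.
rewrite max_l//; set p := Phi _.
suff : p <= 2^-1 by lra.
by rewrite -Phi0 Phi_mono ler_pdivrMr// mul0r ltW// ltNge.
Qed.

End brownian_maximum.

(** * The probability integral transform *)

Lemma uniform_prob_lray (R : realType) (u : R) :
  uniform_prob (@ltr01 R) `]-oo, u] = (Num.max 0 (Num.min u 1))%:E.
Proof.
rewrite /uniform_prob integral_uniform_pdf.
have -> : `]-oo, u] `&` `[0 : R, 1] = `[0, Num.min u 1]%classic.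
  apply/seteqP; split => x /=; rewrite !in_itv/= le_min.
    by move=> [-> /andP[-> ->]].
  by move=> /and3P[-> -> ->].
rewrite (eq_integral (cst 1%E)); last first.
  move=> x; rewrite inE/= in_itv/= le_min /uniform_pdf => /and3P[-> _ ->].
  by rewrite subr0 invr1.
rewrite integral_cst//= mul1e lebesgue_measure_itv/= lte_fin.
by case: ltP => h //; rewrite -EFinB subr0.
Qed.

Lemma ex_uniform (R : realType) : exists U : probability R R,
  forall A : set R, U A = uniform_prob (@ltr01 R) A.
Proof.
have mI : measurable_fun [set: measurableTypeR R] (idfun : _ -> R).
  exact: measurable_id.
have [U UE] := ex_pushforward (uniform_prob (@ltr01 R)) mI.
by exists U; exact: UE.
Qed.

Section probability_integral_transform.
Context d (T : measurableType d) (R : realType) (P : probability T R).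
Variable X : {RV P >-> R}.
Hypothesis cX : continuous (fcdf X).

Lemma fcdfE x : P [set w | X w <= x] = (fcdf X x)%:E.
Proof.
by rewrite /fcdf fineK ?fin_num_measure.
Qed.

Lemma fcdf_nondecreasing : {homo fcdf X : x y / x <= y}.
Proof.
by move=> x y xy; rewrite /fcdf fine_le ?fin_num_measure// cdf_nondecreasing.
Qed.

Lemma fcdf_ge0 x : 0 <= fcdf X x. Proof. by rewrite fine_ge0. Qed.

Lemma fcdf_le1 x : fcdf X x <= 1.
Proof. by rewrite -lee_fin fineK ?fin_num_measure// cdf_le1. Qed.

Lemma fcdf_surj u : 0 < u < 1 -> exists x, fcdf X x = u.
Proof.
move=> /andP[u0 u1].
have [a au] : exists a : R, fcdf X a < u.
  have h : fcdf X x @[x --> -oo] --> (0 : R) by apply/fine_cvg/cvg_cdfNy0.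
  have : \forall x \near -oo, fcdf X x < u by exact: cvgr_lt h _ u0.
  by move=> /(@filter_ex _ _ _)[a]; exists a.
have [b bu] : exists b : R, u < fcdf X b.
  have h : fcdf X x @[x --> +oo] --> (1 : R) by apply/fine_cvg/cvg_cdfy1.
  have : \forall x \near +oo, u < fcdf X x by exact: cvgr_gt h _ u1.
  by move=> /(@filter_ex _ _ _)[b]; exists b.
have ab : a <= b.
  by rewrite leNgt; apply/negP => /ltW/fcdf_nondecreasing; lra.
have [|||c _ <-] := @IVT R (fcdf X) a b u => //; last by exists c.
  exact: continuous_subspaceT.
by rewrite ge_min le_max (ltW au) (ltW bu) orbT.
Qed.

Lemma measurable_fcdf : measurable_fun setT (fcdf X \o X).
Proof.
by apply: measurableT_comp => //; exact: continuous_measurable_fun.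
Qed.

(** For [0 < u < 1] a point [x] of level [u] gives the lower bound. It may fail to give the upper
    one, as the distribution function can be flat at [u]; a point of a slightly higher level [u']
    does, up to [e]. *)
Lemma fcdf_transform u :
  P [set w | fcdf X (X w) <= u] = (Num.max 0 (Num.min u 1))%:E.
Proof.
have mX u' : measurable [set w | fcdf X (X w) <= u'].
  rewrite -[X in measurable X]setTI; apply: measurable_fun_ler => //.
  exact: measurable_fcdf.
have [u0|u0] := ltP u 0.
  rewrite max_l; last by rewrite ge_min ltW.
  rewrite (_ : mkset _ = set0) ?measure0//.
  apply/seteqP; split => // w /= h; move: (le_lt_trans h u0).
  by rewrite ltNge fcdf_ge0.
have [u1|u1] := leP 1 u.
  rewrite max_r// (_ : mkset _ = setT) ?probability_setT//.
  by apply/seteqP; split => // w _ /=; rewrite (le_trans (fcdf_le1 _)).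
rewrite max_r//; apply/eqP; rewrite eq_le; apply/andP; split; last first.
  have [<-|u_neq0] := eqVneq 0 u; first exact: measure_ge0.
  have [|x xu] := @fcdf_surj u; first by rewrite lt_neqAle u_neq0 u0.
  rewrite -xu -fcdfE; apply: le_measure; rewrite ?inE.
  - by rewrite -[X in measurable X]setTI; exact: measurable_fun_ler.
  - exact: mX.
  - by move=> w /= /fcdf_nondecreasing.
apply/lee_addgt0Pr => e e0.
(* The second bound keeps [u'] below 1, so that this level is attained. *)
pose u' := Num.min (u + e) ((u + 1) / 2).
have uu' : u < u' by rewrite /u' lt_min; apply/andP; split; lra.
have u'1 : u' < 1 by rewrite /u' gt_min; apply/orP; right; lra.
have [|x xu'] := @fcdf_surj u'; first by rewrite (le_lt_trans u0).
apply: (@le_trans _ _ u'%:E); last first.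
  by rewrite -EFinD lee_fin /u' ge_min lexx.
rewrite -xu' -fcdfE; apply: le_measure; rewrite ?inE.
- exact: mX.
- by rewrite -[X in measurable X]setTI; exact: measurable_fun_ler.
- move=> w /= h; rewrite leNgt; apply/negP => /ltW/fcdf_nondecreasing.
  by rewrite xu'; lra.
Qed.

Lemma fcdf_uniform (A : set R) : measurable A ->
  P ((fcdf X \o X) @^-1` A) = uniform_prob (@ltr01 R) A.
Proof.
move=> mA.
have [U UE] := ex_uniform R.
have [Q QE] := ex_pushforward P measurable_fcdf.
rewrite -QE -UE; apply: measureR_unique => //; last first.
  by move=> x; rewrite (le_lt_trans (probability_le1 _ _))// ?ltry.
move=> u; rewrite [LHS]QE [RHS]UE uniform_prob_lray -fcdf_transform.
by congr (P _); apply/seteqP; split => w /=; rewrite in_itv.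
Qed.

(** The event [X <= x] is contained in the event that [fcdf X (X w) <= fcdf X x], and both have
    probability [fcdf X x]: they differ by a null set even where [fcdf X] is flat. *)
Lemma fcdf_inv_ae x : {ae P, forall w, fcdf X (X w) <= fcdf X x -> X w <= x}.
Proof.
have m1 : measurable [set w | fcdf X (X w) <= fcdf X x].
  rewrite -[X in measurable X]setTI; apply: measurable_fun_ler => //.
  exact: measurable_fcdf.
have m2 : measurable [set w | X w <= x].
  by rewrite -[X in measurable X]setTI; exact: measurable_fun_ler.
exists ([set w | fcdf X (X w) <= fcdf X x] `\` [set w | X w <= x]); split.
- exact: measurableD.
- rewrite measureD//; last by rewrite -ge0_fin_numE// fin_num_measure.
  rewrite setIidr; last by move=> w /= /fcdf_nondecreasing.
  have e : P [set w | fcdf X (X w) <= fcdf X x] = (fcdf X x)%:E.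
    by rewrite fcdf_transform min_l ?fcdf_le1// max_r ?fcdf_ge0.
  transitivity ((fcdf X x)%:E - (fcdf X x)%:E)%E; last by rewrite -EFinB subrr.
  by congr (_ - _)%E; [exact: e|exact: fcdfE].
- by move=> w /= /not_implyP[h1 h2]; split.
Qed.

End probability_integral_transform.

(** The copula is the distribution function of the transformed pair; [fcdf_uniform] gives its
    margins and [fcdf_inv_ae] converts its quadrants into those of [(X, Y)]. *)
Lemma sklar_existence d (T : measurableType d) (R : realType)
    (P : probability T R) (X Y : {RV P >-> R}) :
  continuous (fcdf X) -> continuous (fcdf Y) -> exists C, copula_of X Y C.
Proof.
move=> cX cY.
have mXY : measurable_fun setT (fun w => (fcdf X (X w), fcdf Y (Y w))).
  apply/measurable_fun_pair; first exact: measurable_fcdf cX.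
  exact: measurable_fcdf cY.
have [mu muE] := ex_pushforward P mXY.
have muX A : measurable A -> mu (fst @^-1` A) = uniform_prob (@ltr01 R) A.
  by move=> mA; rewrite muE -(fcdf_uniform cX mA).
have muY A : measurable A -> mu (snd @^-1` A) = uniform_prob (@ltr01 R) A.
  by move=> mA; rewrite muE -(fcdf_uniform cY mA).
exists (fun u v => fine (mu (`]-oo, u] `*` `]-oo, v]))); split => //.
  exists mu; split => // u v _ _.
  by rewrite fineK// fin_num_measure//; exact: measurableX.
move=> x y; rewrite fineK; last first.
  by rewrite fin_num_measure//; exact: measurableX.
rewrite muE; apply: eq_measure_ae.
- apply: measurableI.
    by rewrite -[X in measurable X]setTI; exact: measurable_fun_ler.
  by rewrite -[X in measurable X]setTI; exact: measurable_fun_ler.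
- by rewrite -[X in measurable X]setTI; apply: mXY => //; exact: measurableX.
- apply: filterS2 (fcdf_inv_ae cX x) (fcdf_inv_ae cY y) => w hx hy /=.
  rewrite !in_itv/=; split => -[h1 h2]; split.
  + exact: fcdf_nondecreasing.
  + exact: fcdf_nondecreasing.
  + exact: hx.
  + exact: hy.
Qed.

(** * Measures on the plane *)

Section plane_measures.
Context (R : realType).
Local Notation lquad u v := (`]-oo, u]%classic `*` `]-oo, v]%classic : set (R * R)).

Lemma measurable_lquadE : @measurable _ (R * R)%type =
  <<s [set A | exists u v : R, A = lquad u v] >>.
Proof.
set G := [set A | _].
have GR : <<s G >> `<=` measurable.
  apply: smallest_sub; first exact: sigma_algebra_measurable.
  by move=> _ [u [v ->]]; exact: measurableX.
rewrite eqEsubset; split => //.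
have hG A : (exists A' : nat -> set (R * R),
    (forall n, G (A' n)) /\ A = \bigcup_n A' n) -> <<s G >> A.
  move=> [A' [GA' ->]]; apply: sigma_algebra_bigcup => n.
  by apply: sub_sigma_algebra.
apply: smallest_sub; first exact: smallest_sigma_algebra.
have key (f : R * R -> R) : (forall u, <<s G >> (f @^-1` `]-oo, u]%classic)) ->
    preimage_set_system setT f (@measurable _ R) `<=` <<s G >>.
  move=> fG; rewrite measurable_lrayE -g_sigma_preimageE.
  apply: smallest_sub; first exact: smallest_sigma_algebra.
  by move=> _ [_ [u ->] <-]; rewrite setTI.
rewrite subUset; split; apply: key => u; apply: hG.
- exists (fun n => lquad u n%:R); split; first by move=> n; exists u, n%:R.
  apply/seteqP; split => [[x y] /= xu|[x y] [n _ [/= + _]]//].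
  have [n _ yn] : (\bigcup_n `]-oo, n%:R : R]%classic) y by rewrite lray_bigcup.
  by exists n.
- exists (fun n => lquad n%:R u); split; first by move=> n; exists n%:R, u.
  apply/seteqP; split => [[x y] /= xu|[x y] [n _ [/= _ +]]//].
  have [n _ yn] : (\bigcup_n `]-oo, n%:R : R]%classic) x by rewrite lray_bigcup.
  by exists n.
Qed.

Lemma measureR2_unique (m1 m2 : {measure set (R * R) -> \bar R}) :
  (forall u v, m1 (lquad u v) = m2 (lquad u v)) ->
  (forall u v, (m1 (lquad u v) < +oo)%E) ->
  forall A, measurable A -> m1 A = m2 A.
Proof.
move=> m12 moo A mA.
apply: (measure_unique _ (fun n => lquad n%:R n%:R) measurable_lquadE) => //.
- move=> _ _ [u [v ->]] [u' [v' ->]]; exists (Num.min u u'), (Num.min v v').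
  by rewrite -setXI !lray_setI.
- by move=> n; exists n%:R, n%:R.
- rewrite -subTset => -[x y] _.
  have [n _ xn] : (\bigcup_n `]-oo, n%:R : R]%classic) x by rewrite lray_bigcup.
  have [n' _ yn] : (\bigcup_n `]-oo, n%:R : R]%classic) y by rewrite lray_bigcup.
  exists (maxn n n') => //=; move: xn yn; rewrite /= !in_itv/= => xn yn; split => /=.
    by rewrite (le_trans xn)// ler_nat leq_maxl.
  by rewrite (le_trans yn)// ler_nat leq_maxr.
- by move=> _ [u [v ->]].
Qed.

Lemma measurable_unit_square : measurable (@unit_square R).
Proof. exact: measurableX. Qed.

(** The test rectangles stay away from [0] in the first variable and from [1] in both, where
    [Phi_inv] is not controlled. They exhaust the part of each quadrant inside the square, and
    continuity from below concludes. *)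
Lemma unit_square_measure_unique (m1 m2 : {measure set (R * R) -> \bar R}) :
  m1 (~` unit_square) = 0%E -> m2 (~` unit_square) = 0%E ->
  (m1 setT < +oo)%E ->
  (forall a u v, 0 < a -> a < u -> u < 1 -> 0 < v -> v < 1 ->
     m1 (`]a, u]%classic `*` `]-oo, v]%classic) =
     m2 (`]a, u]%classic `*` `]-oo, v]%classic)) ->
  forall A, measurable A -> m1 A = m2 A.
Proof.
move=> m1sq m2sq m1oo m12.
have msq := measurable_unit_square.
have restr (m : {measure set (R * R) -> \bar R}) A : measurable A ->
    m (~` unit_square) = 0%E -> m A = m (A `&` unit_square).
  move=> mA m0.
  rewrite -[in LHS](setUIDK A unit_square) measureU0//.
  + exact: measurableI.
  + exact: measurableD.
  apply/eqP; rewrite -measure_le0 -m0; apply: le_measure; rewrite ?inE//.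
  + exact: measurableD.
  + exact: measurableC.
apply: measureR2_unique; last first.
  move=> u v; apply: le_lt_trans m1oo; apply: le_measure; rewrite ?inE//.
  exact: measurableX.
move=> u v.
pose a n : R := n.+2%:R^-1.
have a0 n : 0 < a n by rewrite invr_gt0 ltr0n.
have a_ni i j : (i <= j)%N -> a j <= a i.
  by move=> ij; rewrite lef_pV2 ?posrE// ler_nat.
pose B n := `]a n, Num.min u (1 - a n)]%classic `*`
  `]-oo, Num.min v (1 - a n)]%classic.
have mB n : measurable (B n) by exact: measurableX.
have ndB : nondecreasing_seq B.
  move=> i j /a_ni aij; apply/subsetPset => -[x y] /= [].
  rewrite /= !in_itv/= !le_min => /andP[ax /andP[xu x1]] /andP[yv y1].
  split => /=; rewrite in_itv/= le_min; first by apply/and3P; split=> //; lra.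
  by apply/andP; split=> //; lra.
have UB : lquad u v `&` unit_square = (\bigcup_n B n) `&` unit_square.
  apply/seteqP; split => -[x y].
    move=> [[/= xu yv] [/= x01 y01]]; split => //; move: xu yv x01 y01.
    rewrite /= !in_itv/= => xu yv /andP[x0 x1] /andP[y0 y1].
    pose e := Num.min x (Num.min (1 - x) (1 - y)).
    have e0 : 0 < e by rewrite !lt_min x0 !subr_gt0 x1.
    have [n _ hn] := near_infty_natSinv_lt (PosNum e0).
    have {hn} := hn n.+1 (leqW (leqnn n)) => /=.
    rewrite -/(a n) !lt_min => /and3P[h1 h2 h3].
    exists n => //; split => /=; rewrite in_itv/= le_min.
      by apply/and3P; split=> //; lra.
    by apply/andP; split=> //; lra.
  move=> [[n _ [/=]]].
  rewrite !in_itv/= !le_min => /andP[ax /andP[xu x1]] /andP[yv y1] sq.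
  by split => //; split => /=; rewrite in_itv.
have lim (m : {measure set (R * R) -> \bar R}) : m (~` unit_square) = 0%E ->
    m (B n) @[n --> \oo] --> m (lquad u v).
  move=> m0; rewrite restr//; last exact: measurableX.
  rewrite UB -restr//; last exact: bigcupT_measurable.
  by apply: nondecreasing_cvg_mu => //; exact: bigcupT_measurable.
have eqB n : m1 (B n) = m2 (B n).
  (* In the two degenerate cases [B n] is empty or misses the square; otherwise it is one of the
     test rectangles. *)
  have [au|au] := leP (Num.min u (1 - a n)) (a n).
    rewrite (_ : B n = set0) ?measure0//.
    apply/seteqP; split => // -[x y] [/=]; rewrite in_itv/= => /andP[h1 h2] _.
    by move: (lt_le_trans h1 (le_trans h2 au)); rewrite ltxx.
  have [v0|v0] := leP (Num.min v (1 - a n)) 0.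
    rewrite restr// [RHS]restr// (_ : _ `&` _ = set0) ?measure0//.
    apply/seteqP; split => // -[x y] [[/= _ +] [/= _]].
    rewrite !in_itv/= => h1 /andP[h2 _].
    by move: (lt_le_trans h2 (le_trans h1 v0)); rewrite ltxx.
  have a1 := a0 n.
  by apply: m12 => //; rewrite gt_min; apply/orP; right; lra.
have h1 := lim _ m1sq; have h2 := lim _ m2sq.
have : m1 (B n) @[n --> \oo] --> m2 (lquad u v).
  by rewrite (_ : (fun n => m1 (B n)) = (fun n => m2 (B n)))//; apply/funext.
exact: cvg_unique.
Qed.

End plane_measures.

(** * Integration of the density *)

Section calculus.
Context {R : realType}.
Implicit Types (a b x y u v : R) (f F G : R -> R).

Lemma is_derive_affine G k c x dG : is_derive x (1 : R) G dG ->
  is_derive x (1 : R) (fun x => k * G x + c) (k * dG).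
Proof.
move=> dGx.
have := is_deriveD (is_deriveZ k dGx) (is_derive_cst c x (1 : R)).
by rewrite addr0.
Qed.

Lemma is_derive_continuous F x dF : is_derive x (1 : R) F dF ->
  {for x, continuous F}.
Proof. by case=> /derivable1_diffP/differentiable_continuous. Qed.

Lemma FTC2_is_derive f F a b : a <= b ->
  (forall x, a <= x <= b -> is_derive x (1 : R) F (f x)) ->
  (forall x, a <= x <= b -> {for x, continuous f}) ->
  (\int[lebesgue_measure]_(x in `[a, b]) (f x)%:E)%E = (F b - F a)%:E.
Proof.
rewrite le_eqVlt => /predU1P[<- _ _|ab dF cf].
  by rewrite set_itv1 integral_set1 subrr.
have oo x : x \in `]a, b[ -> a <= x <= b.
  by rewrite in_itv/= => /andP[/ltW -> /ltW ->].
rewrite EFinB; apply: continuous_FTC2 => //.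
- apply: continuous_in_subspaceT => x; rewrite inE/= in_itv/=; exact: cf.
- split.
  + by move=> x /oo /dF[].
  + apply: cvg_at_right_filter; apply: (is_derive_continuous (dF a _)).
    by rewrite lexx ltW.
  + apply: cvg_at_left_filter; apply: (is_derive_continuous (dF b _)).
    by rewrite lexx ltW.
- by move=> x /oo/dF dFx; rewrite derive1E derive_val.
Qed.

End calculus.

Section density.
Context {R : realType}.
Implicit Types (a b x y u v : R).

Definition bm_density u v : R :=
  if u <= (v + 1) / 2
  then (2 * Phi_inv ((v + 1) / 2) - Phi_inv u)
         * phi (2 * Phi_inv ((v + 1) / 2) - Phi_inv u)
         / (phi (Phi_inv ((v + 1) / 2)) * phi (Phi_inv u))
  else 0.

Lemma phi_gt0 x : 0 < phi x :> R.
Proof. exact: normal_pdf_gt0 (oner_neq0 R). Qed.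

Lemma phi_continuous : continuous (@phi R).
Proof. exact: continuous_normal_pdf (oner_neq0 R). Qed.

Lemma Phi_inv_continuous u : 0 < u < 1 -> {for u, continuous (@Phi_inv R)}.
Proof. by move=> /Phi_inv_is_derive/is_derive_continuous. Qed.

Let half_itv v : -1 < v -> v < 1 -> 0 < (v + 1) / 2 < 1.
Proof. by move=> *; apply/andP; split; lra. Qed.

Lemma is_derive_Phi_inv_half v : -1 < v -> v < 1 ->
  is_derive v (1 : R) (fun v => Phi_inv ((v + 1) / 2))
    ((2 * phi (Phi_inv ((v + 1) / 2)))^-1).
Proof.
move=> v1 v2.
have h1 : is_derive v (1 : R) (fun v : R => (v + 1) / 2) 2^-1.
  rewrite (_ : (fun v : R => _) = (fun v : R => 2^-1 * id v + 2^-1)).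
    by rewrite -[X in is_derive _ _ _ X]mulr1; exact: is_derive_affine.
  by apply/funext => z /=; field.
have h2 := Phi_inv_is_derive (half_itv v1 v2).
have := @is_derive1_comp R Phi_inv (fun v : R => (v + 1) / 2) v _ _ h2 h1.
by rewrite invfM mulrC.
Qed.

Let h u v : R := (2 * Phi_inv ((v + 1) / 2) - Phi_inv u)
  * phi (2 * Phi_inv ((v + 1) / 2) - Phi_inv u)
  / (phi (Phi_inv ((v + 1) / 2)) * phi (Phi_inv u)).

(** The range starts at [-1], so that the lower limit [v = 0] of the integration is an interior
    point. The sign comes from [phi' z = - z * phi z], and the factor 2 cancels that of
    [(v + 1) / 2]. *)
Let h_is_derive u v : -1 < v -> v < 1 ->
  is_derive v (1 : R)
   (fun v => - (phi (Phi_inv u))^-1 *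
             phi (2 * Phi_inv ((v + 1) / 2) - Phi_inv u) + 0)
   (h u v).
Proof.
move=> v1 v2.
have h1 := is_derive_affine 2 (- Phi_inv u) (is_derive_Phi_inv_half v1 v2).
have h2 := is_derive_phi (2 * Phi_inv ((v + 1) / 2) - Phi_inv u).
have := @is_derive1_comp R phi _ v _ _ h2 h1.
move=> /(is_derive_affine (- (phi (Phi_inv u))^-1) 0) h3.
apply: is_derive_eq; rewrite /h.
by field; rewrite !gt_eqF ?phi_gt0.
Qed.

Let h_continuous u v : -1 < v -> v < 1 -> {for v, continuous (h u)}.
Proof.
move=> v1 v2; rewrite /h.
have c1 := is_derive_continuous (is_derive_Phi_inv_half v1 v2).
have c2 : 2 * Phi_inv ((z + 1) / 2) - Phi_inv u @[z --> v] -->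
    2 * Phi_inv ((v + 1) / 2) - Phi_inv u.
  by apply: cvgB; [apply: cvgM; [exact: cvg_cst|exact: c1]|exact: cvg_cst].
apply: cvgM; first apply: cvgM.
- exact: c2.
- exact: cvg_comp c2 (@phi_continuous _).
- apply: cvgV; first by rewrite gt_eqF// mulr_gt0 ?phi_gt0.
  by apply: cvgM; [exact: cvg_comp c1 (@phi_continuous _)|exact: cvg_cst].
Qed.

Lemma measurable_bm_density :
  measurable_fun (@unit_square R) (fun p => bm_density p.1 p.2).
Proof.
(* [Phi_inv] is known to be continuous only on []0, 1[]; its restriction is measurable everywhere
   and gives the same density on the square. *)
pose Q : R -> R := Phi_inv \_ `]0, 1[.
have mQ : measurable_fun setT Q.
  apply: (measurable_restrictT Phi_inv (measurable_itv `]0, 1[)).1.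
  apply: open_continuous_measurable_fun => //.
  by move=> x; rewrite inE/= in_itv/= => x01; exact: Phi_inv_continuous.
have mphi : measurable_fun setT (@phi R) by exact: measurable_normal_pdf.
have mphiV : measurable_fun setT (fun x : R => (phi x)^-1).
  apply: continuous_measurable_fun => x; apply: cvgV; last exact: phi_continuous.
  by rewrite gt_eqF// phi_gt0.
pose q (p : R * R) := Q ((p.2 + 1) / 2).
pose r (p : R * R) := Q p.1.
have m2 : measurable_fun setT (fun p : R * R => (p.2 + 1) / 2).
  by apply: measurable_funM => //; exact: measurable_funD.
have mq : measurable_fun setT q by exact: measurableT_comp mQ m2.
have mr : measurable_fun setT r by exact: measurableT_comp.
have mqr : measurable_fun setT (fun p => 2 * q p - r p).
  by apply: measurable_funB => //; exact: measurable_funM.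
apply: (@eq_measurable_fun _ _ _ _ _ (fun p : R * R =>
  if p.1 <= (p.2 + 1) / 2 then (2 * q p - r p) * phi (2 * q p - r p) *
    ((phi (q p))^-1 * (phi (r p))^-1) else 0)).
  move=> [x y]; rewrite inE => -[/=]; rewrite !in_itv/= => x01 y01.
  have y2 : 0 < (y + 1) / 2 < 1 by apply/andP; split; lra.
  by rewrite /bm_density /q /r /Q /= !patchE !mem_set//= ?in_itv//= invfM.
apply: measurable_funTS; apply: measurable_fun_ifT => //.
  by apply: measurable_fun_ler.
apply: measurable_funM; first apply: measurable_funM => //.
  exact: measurableT_comp mphi mqr.
apply: measurable_funM; first exact: measurableT_comp mphiV mq.
exact: measurableT_comp mphiV mr.
Qed.

Lemma Phi_inv_le u v : 0 < u < 1 -> 0 < v < 1 ->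
  (Phi_inv u <= Phi_inv v :> R) = (u <= v).
Proof. by move=> u01 v01; rewrite -Phi_mono !Phi_invK. Qed.

Lemma bm_density_ge0 (p : R * R) : unit_square p -> 0 <= bm_density p.1 p.2.
Proof.
case: p => u v [/=]; rewrite !in_itv/= => u01 v01; rewrite /bm_density.
case: ifPn => // uv.
have v2 : 0 < (v + 1) / 2 < 1 by apply/andP; split; lra.
(* With [b = Phi_inv ((v + 1) / 2)], this and [Phi_inv u <= b] give
   [2 * b - Phi_inv u >= b >= 0]. *)
have b0 : 0 <= Phi_inv ((v + 1) / 2) :> R.
  by rewrite -Phi_mono Phi_invK// Phi0; lra.
have ab : Phi_inv u <= Phi_inv ((v + 1) / 2) by rewrite Phi_inv_le.
apply: divr_ge0; last by apply/ltW/mulr_gt0; exact: phi_gt0.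
by apply: mulr_ge0; [lra|exact/ltW/phi_gt0].
Qed.

(** The partial derivative of the copula in [u], that is, the conditional probability of [V <= v]
    given [U = u]. *)
Definition bm_section v u : R :=
  if u <= (v + 1) / 2
  then 1 - phi (2 * Phi_inv ((v + 1) / 2) - Phi_inv u) / phi (Phi_inv u)
  else 0.

Lemma integral_bm_density_r u v : 0 < u < 1 -> 0 < v < 1 ->
  (\int[lebesgue_measure]_(y in `]0%R, v]) (bm_density u y)%:E)%E =
  (bm_section v u)%:E.
Proof.
move=> u01 v01.
have mu : measurable_fun (`]0 : R, 1[%classic) (bm_density u).
  have mp := measurable_fun_pair2 u ((measurable_restrictT _
    (@measurable_unit_square R)).1 measurable_bm_density).
  apply: (eq_measurable_fun _ _ (measurable_funTS mp)) => y.
  rewrite inE/= in_itv/= => y01.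
  by rewrite patchE mem_set//; split => /=; rewrite in_itv.
rewrite integral_itv_obnd_cbnd; last first.
  apply/measurable_EFinP; apply: measurable_funS mu => // y /=.
  by rewrite !in_itv/= => /andP[-> yv]; lra.
(* The density at [(u, y)] vanishes when [y < 2 * u - 1], so the integration effectively starts at
   [v0]. *)
pose v0 := Num.max 0 (2 * u - 1).
have v00 : 0 <= v0 by rewrite /v0 le_max lexx.
have v0u : 2 * u - 1 <= v0 by rewrite /v0 le_max lexx orbT.
have bd0 y : 0 <= y -> y < v0 -> bm_density u y = 0.
  by move=> y0; rewrite /v0 lt_max /bm_density => yv; case: ifPn => //; lra.
have bdh y : v0 <= y -> bm_density u y = h u y.
  by move=> yv; rewrite /bm_density -/(h u y) ifT//; lra.
rewrite /bm_section; case: ifPn => uv; last first.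
  apply: integral0_eq => y; rewrite /= in_itv/= => /andP[y0 yv].
  by rewrite bd0//; lra.
have v0v : v0 <= v by rewrite /v0 ge_max; apply/andP; split; lra.
transitivity (\int[lebesgue_measure]_(y in `[v0, v]) (h u y)%:E)%E.
  rewrite integral_mkcond [RHS]integral_mkcond; apply: eq_integral => y _.
  rewrite !patchE !mem_setE /= !in_itv/=.
  have [yv|yv] := leP y v; last by rewrite !andbF.
  have [v0y|v0y] := leP v0 y; first by rewrite (le_trans v00)//= bdh.
  by case: ifPn => //= /andP[y0 _]; rewrite bd0.
pose H y : R := - (phi (Phi_inv u))^-1 *
  phi (2 * Phi_inv ((y + 1) / 2) - Phi_inv u) + 0.
have dH y : v0 <= y <= v -> is_derive y (1 : R) H (h u y).
  by move=> /andP[y1 y2]; apply: h_is_derive; lra.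
have ch y : v0 <= y <= v -> {for y, continuous (h u)}.
  by move=> /andP[y1 y2]; apply: h_continuous; lra.
apply: etrans (FTC2_is_derive v0v dH ch) _; rewrite /H.
(* Source of the constant 1 in [bm_section]: either [(v0 + 1) / 2 = u] and the argument is
   [Phi_inv u], or [v0 = 0], [Phi_inv (1 / 2) = 0] and [phi] is even. *)
have -> : phi (2 * Phi_inv ((v0 + 1) / 2) - Phi_inv u) = phi (Phi_inv u).
  rewrite /v0; case: (leP 0 (2 * u - 1)) => h0.
    have -> : (2 * u - 1 + 1) / 2 = u by field.
    by congr phi; ring.
  rewrite add0r mul1r -Phi0 PhiK mulr0 sub0r; exact: phiN.
by congr _%:E; field; rewrite gt_eqF// phi_gt0.
Qed.

(* Truncating [u] at [w = (v + 1) / 2] covers both cases of the formula: at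
   [u = w] the expression equals [w - Phi (- Phi_inv w) = 2 * w - 1 = v]. *)
Definition bm_copula u v : R :=
  let w := Num.min u ((v + 1) / 2) in
  w - Phi (Phi_inv w - 2 * Phi_inv ((v + 1) / 2)).

Lemma integral_bm_section a u v : 0 < a -> a < u -> u < 1 -> 0 < v < 1 ->
  (\int[lebesgue_measure]_(x in `]a, u]) (bm_section v x)%:E)%E =
  (bm_copula u v - bm_copula a v)%:E.
Proof.
move=> a0 au u1 v01; rewrite /bm_copula /bm_section.
set w := (v + 1) / 2; set b := Phi_inv w.
have w01 : 0 < w < 1 by rewrite /w; apply/andP; split; lra.
pose k x : R := 1 - phi (2 * b - Phi_inv x) / phi (Phi_inv x).
pose K x : R := x - Phi (Phi_inv x - 2 * b).
have ck x : 0 < x < 1 -> {for x, continuous k}.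
  move=> x01.
  have c1 := Phi_inv_continuous x01.
  apply: cvgB; first exact: cvg_cst.
  apply: cvgM.
    have c2 : 2 * b - Phi_inv z @[z --> x] --> 2 * b - Phi_inv x.
      by apply: cvgB; [exact: cvg_cst|exact: c1].
    exact: cvg_comp c2 (@phi_continuous _).
  apply: cvgV; first by rewrite gt_eqF// phi_gt0.
  exact: cvg_comp c1 (@phi_continuous _).
have dK x : 0 < x < 1 -> is_derive x (1 : R) K (k x).
  move=> x01.
  have h1 := is_derive_affine 1 (- (2 * b)) (Phi_inv_is_derive x01).
  have h2 := @is_derive1_comp R Phi _ x _ _ (is_derive_Phi _) h1.
  have h3 := is_deriveB (is_derive_id x (1 : R)) h2.
  have -> : K = (id : R -> R) - (Phi \o (fun x => 1 * Phi_inv x - 2 * b)).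
    by apply/funext => z; rewrite /K !fctE/= mul1r.
  apply: is_derive_eq; rewrite /k mul1r mul1r -phiN; congr (_ - phi _ / _); ring.
have mk : measurable_fun (`]0 : R, 1[%classic) k.
  apply: open_continuous_measurable_fun => //.
  by move=> x; rewrite inE/= in_itv/= => x01; exact: ck.
have ms : measurable_fun (`]0 : R, 1[%classic) (fun x => if x <= w then k x else 0).
  apply: measurable_fun_if => //.
    by apply: measurable_fun_ler.
  by apply: measurable_funS mk.
rewrite integral_itv_obnd_cbnd; last first.
  apply/measurable_EFinP; apply: measurable_funS ms => // y /=.
  by rewrite !in_itv/= => /andP[ay yu]; lra.
(* If [w < a], the section vanishes on the interval and both truncated arguments equal [w];
   otherwise the integral stops at [e = Num.min u w]. *)
have [wa|aw] := ltP w a.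
  rewrite !min_r ?(ltW wa) ?(ltW (lt_trans wa au))// subrr.
  apply: integral0_eq => x; rewrite /= in_itv/= => /andP[ax _].
  by rewrite leNgt (lt_le_trans wa ax).
set e := Num.min u w.
have ae : a <= e by rewrite /e le_min aw ltW.
have eu : e <= u by rewrite /e ge_min lexx.
have ew : e <= w by rewrite /e ge_min lexx orbT.
transitivity (\int[lebesgue_measure]_(x in `[a, e]) (k x)%:E)%E.
  rewrite integral_mkcond [RHS]integral_mkcond; apply: eq_integral => y _.
  rewrite !patchE !mem_setE /= !in_itv/= /e le_min.
  case: (a <= y) => //=; case: (y <= u) => //=.
  by case: (y <= w).
have dK' x : a <= x <= e -> is_derive x (1 : R) K (k x).
  by move=> /andP[x1 x2]; apply: dK; lra.
have ck' x : a <= x <= e -> {for x, continuous k}.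
  by move=> /andP[x1 x2]; apply: ck; lra.
exact: FTC2_is_derive ae dK' ck'.
Qed.

End density.

(** * Measures given by a density *)

Section density_measure.
Context d (T : measurableType d) (R : realType).
Variables (m : {measure set T -> \bar R}) (D : set T) (f : T -> \bar R).
Hypotheses (mD : measurable D) (mf : measurable_fun D f)
  (f0 : forall x, D x -> (0 <= f x)%E).

Definition density_measure (A : set T) : \bar R :=
  (\int[m]_(x in A `&` D) f x)%E.

Let density_measure0 : density_measure set0 = 0%E.
Proof. by rewrite /density_measure set0I integral_set0. Qed.

Let density_measure_ge0 A : (0 <= density_measure A)%E.
Proof. by apply: integral_ge0 => x [_]; exact: f0. Qed.

Let density_measure_sigma_additive : semi_sigma_additive density_measure.
Proof.
move=> F mF tF mUF; rewrite /density_measure; apply: cvg_toP.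
  apply: ereal_nondecreasing_is_cvgn => i j ij.
  apply: lee_sum_nneg_natr => // k _ _.
  by apply: integral_ge0 => x [_]; exact: f0.
rewrite setI_bigcupl ge0_integral_bigcup//.
- by move=> k; exact: measurableI.
- rewrite -setI_bigcupl; exact: measurable_funS mD (@subIsetr _ _ _) mf.
- by move=> x [k _ [_]]; exact: f0.
- exact: trivIset_setIr.
Qed.

HB.instance Definition _ := isMeasure.Build _ _ _ density_measure
  density_measure0 density_measure_ge0 density_measure_sigma_additive.

Lemma ex_density_measure : exists nu : {measure set T -> \bar R},
  forall A, nu A = (\int[m]_(x in A `&` D) f x)%E.
Proof. by exists density_measure. Qed.

End density_measure.

(** * The copula measure has the stated density *)

Section copula_density_of_brownian_maximum.
Context {R : realType}.

Lemma bm_copulaE (u v : R) : 0 < v < 1 ->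
  bm_copula u v = if u <= (v + 1) / 2
    then u - Phi (Phi_inv u - 2 * Phi_inv ((v + 1) / 2)) else v.
Proof.
move=> v01; rewrite /bm_copula.
have w01 : 0 < (v + 1) / 2 < 1 by apply/andP; split; lra.
case: (leP u ((v + 1) / 2)) => // _.
set b := Phi_inv _.
have -> : b - 2 * b = - b by ring.
by rewrite PhiN Phi_invK//; field.
Qed.

Lemma uniform_prob_setC01 : uniform_prob (@ltr01 R) (~` `]0, 1[) = 0%E.
Proof.
have [U UE] := ex_uniform R.
rewrite -UE probability_setC// UE /uniform_prob integral_uniform_pdf.
rewrite (_ : `]0, 1[ `&` `[0 : R, 1] = `]0 : R, 1[%classic); last first.
  apply/setIidl => x /=; rewrite !in_itv/= => /andP[x0 x1].
  by rewrite !ltW.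
rewrite (eq_integral (cst 1%E)); last first.
  move=> x; rewrite inE/= in_itv/= /uniform_pdf => /andP[x0 x1].
  by rewrite !ltW//= subr0 invr1.
rewrite integral_cst//= mul1e lebesgue_measure_itv/= lte_fin ltr01 oppr0 adde0.
by rewrite subee.
Qed.

(** The complement of the square lies in the union of two strips, each null because its margin is
    uniform. *)
Lemma copula_law_setC01 (C : R -> R -> R) mu : copula_law C mu ->
  mu (~` unit_square) = 0%E.
Proof.
move=> [muX muY _].
have mI : measurable (~` `]0 : R, 1[%classic) by exact: measurableC.
have m1 : measurable (fst @^-1` (~` `]0 : R, 1[%classic) : set (R * R)).
  by rewrite -[X in measurable X]setTI; exact: measurable_fst.
have m2 : measurable (snd @^-1` (~` `]0 : R, 1[%classic) : set (R * R)).
  by rewrite -[X in measurable X]setTI; exact: measurable_snd.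
apply/eqP; rewrite -measure_le0.
apply: (@le_trans _ _ (mu ((fst @^-1` (~` `]0 : R, 1[%classic)) `|`
                           (snd @^-1` (~` `]0 : R, 1[%classic))))).
  apply: le_measure; rewrite ?inE.
  - by apply: measurableC; exact: (@measurable_unit_square R).
  - exact: measurableU.
  - move=> [x y] /= /not_andP[h|h]; [by left|by right].
have z1 : mu (fst @^-1` (~` `]0 : R, 1[%classic)) = 0%E.
  by rewrite muX// uniform_prob_setC01.
have z2 : mu (snd @^-1` (~` `]0 : R, 1[%classic)) = 0%E.
  by rewrite muY// uniform_prob_setC01.
by rewrite measureU0// [leLHS]z1.
Qed.

Lemma bm_density_itv (a u v : R) : 0 < a -> a < u -> u < 1 -> 0 < v < 1 ->
  (\int[lebesgue_measure \x lebesgue_measure]_(p in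
     (`]a, u]%classic `*` `]-oo, v]%classic) `&` unit_square)
     (bm_density p.1 p.2)%:E)%E = (bm_copula u v - bm_copula a v)%:E.
Proof.
move=> a0 au u1 v01.
set E := _ `&` _.
have mE : measurable E.
  by apply: measurableI; [exact: measurableX|exact: (@measurable_unit_square R)].
rewrite integral_mkcond.
have EE x y : (x, y) \in E = (x \in `]a, u]) && (y \in `]0, v]).
  apply/idP/idP; rewrite inE /E /= !in_itv/=.
    move=> [[/= h1 h2] [/= _ h3]]; move: h1 h2 h3.
    by rewrite !in_itv/= => -> -> /andP[-> _].
  move=> /andP[/andP[ax xu] /andP[y0 yv]].
  split; split => //=; rewrite ?in_itv/=; try (apply/andP; split); lra.
rewrite fubini_tonelli1; first last.
- move=> [x y]; rewrite patchE; case: ifPn => // xyE.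
  by rewrite lee_fin (@bm_density_ge0 _ (x, y))//; move: xyE; rewrite inE => -[].
- apply: (measurable_restrictT _ mE).1; apply/measurable_EFinP.
  exact: measurable_funS (@measurable_unit_square R) (@subIsetr _ _ _)
    (@measurable_bm_density R).
rewrite -integral_bm_section// [RHS]integral_mkcond; apply: eq_integral => x _.
rewrite /fubini_F patchE mem_setE; case: ifPn => xau.
  have x01 : 0 < x < 1.
    by move: xau; rewrite in_itv/= => /andP[ax xu]; apply/andP; split; lra.
  rewrite -integral_bm_density_r// [RHS]integral_mkcond; apply: eq_integral => y _.
  by rewrite !patchE EE xau mem_setE.
by apply: integral0_eq => y _; rewrite patchE EE (negbTE xau).
Qed.

Lemma bm_copula_density (C : R -> R -> R) :
  is_copula C ->
  (forall u v, 0 < u < 1 -> 0 < v < 1 -> C u v = bm_copula u v) ->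
  copula_density C bm_density.
Proof.
move=> [mu muC] CE; exists mu; split => //.
- exact: measurable_bm_density.
- exact: bm_density_ge0.
have [nu0 nu0E] := @ex_density_measure _ _ _ (lebesgue_measure \x lebesgue_measure)%E
  unit_square (fun p : R * R => (bm_density p.1 p.2)%:E) (@measurable_unit_square R)
  (proj2 (measurable_EFinP _ _) measurable_bm_density) (fun p h => bm_density_ge0 h).
(* As in [ex_normal], the identity moves the density measure to [R * R], the space carrying [mu]. *)
have mI : measurable_fun [set: measurableTypeR R * measurableTypeR R]
    (idfun : _ -> R * R) by exact: measurable_id.
have [nu nuE'] := ex_pushforward_measure nu0 mI.
have nuE A : nu A =
    (\int[lebesgue_measure \x lebesgue_measure]_(p in A `&` unit_square)
    (bm_density p.1 p.2)%:E)%E by rewrite nuE' nu0E.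
move=> A mA; rewrite -nuE.
apply: unit_square_measure_unique => //.
- exact: copula_law_setC01 muC.
- by rewrite nuE setICl integral_set0.
- by rewrite (le_lt_trans (probability_le1 _ _))// ?ltry.
move=> a u v a0 au u1 v0 v1; rewrite nuE bm_density_itv//; last by rewrite v0.
have [_ _ muq] := muC.
(* The rectangle is a difference of two quadrants with corners in the open square, where [C] is
   known. *)
have -> : `]a, u]%classic `*` `]-oo, v]%classic =
    (`]-oo, u]%classic `*` `]-oo, v]%classic) `\`
    (`]-oo, a]%classic `*` `]-oo, v]%classic) :> set (R * R).
  apply/seteqP; split => -[x y] /=; rewrite !in_itv/=.
    by move=> [/andP[ax ->] ->]; split => // -[]; rewrite leNgt ax.
  move=> [[xu yv] h]; split => //; rewrite xu andbT ltNge; apply/negP => xa.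
  exact: h.
rewrite measureD; first last.
- by rewrite -ge0_fin_numE// fin_num_measure//; exact: measurableX.
- exact: measurableX.
- exact: measurableX.
rewrite setIidr; last first.
  by move=> [x y] /= []; rewrite !in_itv/= => xa yv; split => //; lra.
have a1 : a < 1 by lra.
have e1 := muq u v; have e2 := muq a v.
transitivity ((C u v)%:E - (C a v)%:E)%E; last by rewrite -EFinB !CE//; lra.
by congr (_ - _)%E; [apply: e1|apply: e2]; lra.
Qed.

End copula_density_of_brownian_maximum.

(** * Identification of the copula of [W t] and [M] *)

Section copula_of_brownian_maximum.
Context d (T : measurableType d) (R : realType) (P : probability T R).
Variables (W : R -> {RV P >-> R}) (t : R) (M : {RV P >-> R}).
Hypotheses (bmW : standard_brownian_motion W) (t0 : 0 < t)
  (maxM : running_max W t M).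

Lemma fcdf_bm : fcdf (W t) = fun x => Phi (x / Num.sqrt t).
Proof.
by apply/funext => x; apply: EFin_inj; rewrite -fcdfE (bm_cdf bmW t0 maxM).
Qed.

Lemma fcdf_max :
  fcdf M = fun m => Num.max 0 (2 * Phi (m / Num.sqrt t) - 1).
Proof.
by apply/funext => x; apply: EFin_inj; rewrite -fcdfE (max_cdf bmW t0 maxM).
Qed.

Let continuous_Phi_div : continuous (fun x : R => Phi (x / Num.sqrt t)).
Proof.
move=> x; apply: (@cvg_comp _ _ _ (fun x => x / Num.sqrt t) Phi).
  by apply: cvgM; [exact: cvg_id|exact: cvg_cst].
exact: Phi_continuous.
Qed.

Lemma continuous_fcdf_bm : continuous (fcdf (W t)).
Proof. by rewrite fcdf_bm. Qed.

Lemma continuous_fcdf_max : continuous (fcdf M).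
Proof.
rewrite fcdf_max => x.
under [X in continuous_at _ X]eq_fun => m do rewrite maxr_absE add0r sub0r.
have cg : {for x, continuous (fun m : R => 2 * Phi (m / Num.sqrt t) - 1)}.
  apply: cvgB; last exact: cvg_cst.
  by apply: cvgM; [exact: cvg_cst|exact: continuous_Phi_div].
apply: cvgM; [apply: cvgD; first exact: cg|exact: cvg_cst].
by apply: cvg_norm; apply: cvgN.
Qed.

Lemma copula_of_bm_max (C : R -> R -> R) (u v : R) : copula_of (W t) M C ->
  0 < u < 1 -> 0 < v < 1 -> C u v = bm_copula u v.
Proof.
move=> [_ _ _ CE] u01 v01.
pose a : R := Phi_inv u; pose b : R := Phi_inv ((v + 1) / 2).
have w01 : 0 < (v + 1) / 2 < 1 by apply/andP; split; lra.
have st0 : 0 < Num.sqrt t by rewrite sqrtr_gt0.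
have b0 : 0 <= b by rewrite -Phi_mono Phi_invK// Phi0; lra.
have := CE (a * Num.sqrt t) (b * Num.sqrt t).
(* At [x = a * sqrt t] and [m = b * sqrt t] the two distribution functions take the values [u] and
   [2 * ((v + 1) / 2) - 1 = v]; [b >= 0] selects the nonzero branch of the joint law. *)
rewrite (bm_max_cdf bmW t0 maxM) fcdf_bm fcdf_max !mulfK ?gt_eqF//.
rewrite !Phi_invK// (mulr_ge0 b0 (ltW st0)) => -[].
have -> : 2 * ((v + 1) / 2) - 1 = v by field.
rewrite max_r; last by lra.
move=> <-; rewrite /bm_copula -(minr_pMl _ _ (ltW st0)) mulfK ?gt_eqF//.
have <- : Phi (Num.min a b) = Num.min u ((v + 1) / 2).
  rewrite /Num.min -[in RHS](Phi_invK u01) -[in RHS](Phi_invK w01).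
  by rewrite Phi_ltmono; case: ifP.
rewrite PhiK -/b.
have -> // : (Num.min a b * Num.sqrt t - 2 * (b * Num.sqrt t)) / Num.sqrt t =
  Num.min a b - 2 * b by field; rewrite gt_eqF.
Qed.

End copula_of_brownian_maximum.
Unset Implicit Arguments.

Theorem mainTheorem1 (R : realType) (d : measure_display)
    (T : measurableType d) (P : probability T R)
    (W : R -> {RV P >-> R}) (t : R) (M : {RV P >-> R}) :
  standard_brownian_motion W -> 0 < t -> running_max W t M ->
  (exists C : R -> R -> R, copula_of (W t) M C) /\
  (forall C : R -> R -> R, copula_of (W t) M C ->
     (forall u v : R, 0 < u < 1 -> 0 < v < 1 ->
        C u v =
          if u <= (v + 1) / 2
          then u - Phi (Phi_inv u - 2 * Phi_inv ((v + 1) / 2))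
          else v) /\
     copula_density C (fun u v : R =>
       if u <= (v + 1) / 2
       then (2 * Phi_inv ((v + 1) / 2) - Phi_inv u)
              * phi (2 * Phi_inv ((v + 1) / 2) - Phi_inv u)
              / (phi (Phi_inv ((v + 1) / 2)) * phi (Phi_inv u))
       else 0)).
Proof.
move=> bmW t0 maxM; split.
  apply: sklar_existence; first exact: continuous_fcdf_bm bmW t0 maxM.
  exact: continuous_fcdf_max bmW t0 maxM.
move=> C CC; split.
  by move=> u v u01 v01; rewrite (copula_of_bm_max bmW t0 maxM CC)// bm_copulaE.
apply: bm_copula_density; first by case: CC.
by move=> u v u01 v01; rewrite (copula_of_bm_max bmW t0 maxM CC).
Qed.
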